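(* There are only five kinds of $m$-type Schrödinger-Virasoro Lie conformal algebras. That is, the $m$-type Schrödinger-Virasoro Lie conformal algebras $L_s=He_0\oplus He_1\oplus He_2$, with pseudobrackets $$[e_0,e_0]=\alpha\otimes_He_0,\quad [e_0,e_i]=\beta_i\otimes_He_i\ (i=1,2),\quad [e_1,e_1]=\alpha_m'\otimes_He_2,\quad [e_1,e_2]=\eta\otimes_He_2,\quad [e_2,e_2]=0,$$ are exactly the following: (A) $m=0$: $\alpha_0'=0$, $\beta_1=\lambda_1s\otimes1-1\otimes s+\kappa_1\otimes1$, $\beta_2=\lambda_2s\otimes1-1\otimes s+\kappa_2\otimes1$, $\eta=a\otimes1$, where $\lambda_1,\lambda_2,\kappa_1,\kappa_2,a\in\mathbf{k}$ satisfy $a\lambda_1=a\kappa_1=0$. (B) $m=1$: $\alpha_1'=w_{01}(1\otimes s-s\otimes1)\neq0$, $\beta_1=\lambda_1s\otimes1-1\otimes s+\kappa_1\otimes1$, $\beta_2=(2\lambda_1-1)s\otimes1-1\otimes s+2\kappa_1\otimes1$, $\eta=a\otimes1$, where $\lambda_1,\kappa_1,w_{01},a\in\mathbf{k}$ satisfy $a\lambda_1=a\kappa_1=0$. (C) $m=2$: $\alpha_2''=w_{02}\big((1\otimes s^{(2)}-s^{(2)}\otimes1)-\kappa_1(1\otimes s-s\otimes1)\big)\neq0$ (in the role of $\alpha'_m$), $\eta=0$, $\beta_1=\frac12s\otimes1-1\otimes s+\kappa_1\otimes1$, $\beta_2=-s\otimes1-1\otimes s+2\kappa_1\otimes1$,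 where $w_{02},\kappa_1\in\mathbf{k}$. (D) $m=2$: $\alpha_2'=-w_{12}\big(\kappa_1(1\otimes s^{(2)}-s^{(2)}\otimes1)-(s\otimes s^{(2)}-s^{(2)}\otimes s)-\frac{\kappa_1^2}2(1\otimes s-s\otimes1)\big)\neq0$, $\eta=0$, $\beta_1=-1\otimes s+\kappa_1\otimes1$, $\beta_2=-3s\otimes1-1\otimes s+2\kappa_1\otimes1$, where $w_{12},\kappa_1\in\mathbf{k}$. (E) $m=3$: $\alpha_3'=w_{03}\big((1\otimes s^{(3)}-s^{(3)}\otimes1)+\frac12(s\otimes s^{(2)}-s^{(2)}\otimes s)-\frac{3\kappa_1}2(1\otimes s^{(2)}-s^{(2)}\otimes1)+\frac34\kappa_1^2(1\otimes s-s\otimes1)\big)$, $\eta=0$, $\beta_1=\frac23s\otimes1-1\otimes s+\kappa_1\otimes1$, $\beta_2=-\frac53s\otimes1-1\otimes s+2\kappa_1\otimes1$, where $w_{03},\kappa_1\in\mathbf{k}$, $w_{03}\neq0$.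
   Context: $\mathbf{k}$ is a field of characteristic zero, $\otimes=\otimes_{\mathbf{k}}$, and $H=\mathbf{k}[s]$ is the Hopf algebra with $\Delta(s)=s\otimes1+1\otimes s$; $s^{(n)}=s^n/n!$. $H^{\otimes n}$ is a right $H$-module via the iterated coproduct. $(12)$ interchanges the first two tensor factors. An $H$-pseudoalgebra is a left $H$-module $A$ with a map $[\cdot,\cdot]:A\otimes A\to H^{\otimes2}\otimes_HA$ such that $[h_1a,h_2b]=(h_1\otimes h_2\otimes_H1)[a,b]$. It is extended as follows: if $[a,b]=\sum_if_i\otimes_Hc_i$ and $[c_i,d]=\sum_jg_{ij}\otimes_Hd_{ij}$, then $[[a,b],d]=\sum(f_i\otimes1)(\Delta\otimes\mathrm{id})(g_{ij})\otimes_Hd_{ij}$; if $[d,c_i]=\sum_jg'_{ij}\otimes_Hd'_{ij}$, then $[d,[a,b]]=\sum(1\otimes f_i)(\mathrm{id}\otimes\Delta)(g'_{ij})\otimes_Hd'_{ij}$. It is a Lie $H$-pseudoalgebra if $[[a,b],c]=[a,[b,c]]-((12)\otimes_H1)[b,[a,c]]$ and $[a,b]=-((12)\otimes_H1)[b,a]$ for all $a,b,c$. Put $\alpha=s\otimes1-1\otimes s$ and $\beta_i=\lambda_is\otimes1-1\otimes s+\kappa_i\otimes1$ with $\lambda_i,\kappa_i\in\mathbf{k}$. For $m\ge0$, an $m$-type Schrödinger-Virasoro Lie conformal algebra (or $H$-pseudoalgebra) is a free $H$-module $L_s$ with basis $\{e_0,e_1,e_2\}$ that is a Lie $H$-pseudoalgebra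 with the pseudobrackets displayed in the claim (the brackets $[e_j,e_i]$, $j>i$, being given by skew-symmetry), where $\eta\in H^{\otimes2}$, $\alpha_0'=0$, and for $m\ge1$, $\alpha_m'=\sum_{0\le i<j\le m}w_{ij}(s^{(i)}\otimes s^{(j)}-s^{(j)}\otimes s^{(i)})$ with $w_{ij}\in\mathbf{k}$ and the $w_{im}$ $(0\le i<m)$ not all zero. *)

(* Defs.v *)
From HB Require Import structures.
From mathcomp Require Import all_boot all_order all_algebra perm.
From mathcomp Require Import generic_quotient ring_quotient boolp.
From mathcomp Require Import freeg mpoly.

Set Implicit Arguments.
Unset Strict Implicit.
Unset Printing Implicit Defensive.

Import GRing.Theory.
Local Open Scope ring_scope.
Local Open Scope quotient_scope.

(* H = k[s] is {poly k} with s = 'X, and the n-th tensor power of H over k is *)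
(* {mpoly k[n]}: the variable 'X_i stands for s in tensor position i, counted *)
(* from 0, and 1 in the other positions.                                      *)
Section TensorPowers.
Variable k : fieldType.

Definition slot n (i : 'I_n) (h : {poly k}) : {mpoly k[n]} :=
  (map_poly (@mpolyC n k) h).['X_i].

Definition tens (h1 h2 : {poly k}) : {mpoly k[2]} := slot 0 h1 * slot 1 h2.

(* The iterated coproduct, i.e. the algebra morphism sending s to the sum of  *)
(* the 'X_i; h acts on the right of the tensor power as multiplication by     *)
(* coprod n h.                                                                *)
Definition coprod n (h : {poly k}) : {mpoly k[n]} :=
  (map_poly (@mpolyC n k) h).[\sum_(i < n) 'X_i].

Local Notation x_ i := ('X_(i%R : 'I_3) : {mpoly k[3]}).

(* f (x) 1 and 1 (x) f *)
Definition tens1r (f : {mpoly k[2]}) : {mpoly k[3]} := f \mPo [tuple x_ 0; x_ 1].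
Definition tens1l (f : {mpoly k[2]}) : {mpoly k[3]} := f \mPo [tuple x_ 1; x_ 2].
(* (Delta (x) id) f and (id (x) Delta) f *)
Definition coprod_id (f : {mpoly k[2]}) : {mpoly k[3]} :=
  f \mPo [tuple x_ 0 + x_ 1; x_ 2].
Definition id_coprod (f : {mpoly k[2]}) : {mpoly k[3]} :=
  f \mPo [tuple x_ 0; x_ 1 + x_ 2].

Definition swap12 n (f : {mpoly k[n.+2]}) : {mpoly k[n.+2]} :=
  msym (tperm 0 1) f.

End TensorPowers.

Notation "h1 \ox h2" := (tens h1 h2) (at level 40, no associativity) : ring_scope.

(* The tensor product over H of {mpoly k[n]} and A is the free abelian group  *)
(* on {mpoly k[n]} * A modulo the subgroup generated by the relations below.  *)
Inductive hrel (k : fieldType) (n : nat) (A : lmodType {poly k}) :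
    {freeg ({mpoly k[n]} * A)%type} -> Prop :=
| hrel0 : hrel 0
| hrelB x y : hrel x -> hrel y -> hrel (x - y)
| hrelDl f g a : hrel (<< (f + g, a) >> - << (f, a) >> - << (g, a) >>)
| hrelDr f a b : hrel (<< (f, a + b) >> - << (f, a) >> - << (f, b) >>)
| hrelZ f h a : hrel (<< (f * coprod n h, a) >> - << (f, h *: a) >>).

Section TensorOverH.
Variables (k : fieldType) (n : nat) (A : lmodType {poly k}).

Definition hrelb : {pred {freeg ({mpoly k[n]} * A)%type}} :=
  fun x => `[< hrel x >].

Fact hrelb_zmod_closed : zmod_closed hrelb.
Proof.
split; first by apply/asboolP; exact: hrel0.
by move=> x y /asboolP hx /asboolP hy; apply/asboolP; exact: hrelB.
Qed.
HB.instance Definition _ := GRing.isZmodClosed.Build _ hrelb hrelb_zmod_closed.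

Definition htens : Type := Quotient.quot hrelb.
HB.instance Definition _ := GRing.Zmodule.on htens.
HB.instance Definition _ := ZmodQuotient.on htens.

Definition hpure (f : {mpoly k[n]}) (a : A) : htens := \pi_htens << (f, a) >>.

(* The additive map f (x)_H a |-> phi f a.  It is computed on a chosen        *)
(* representative, which is immaterial for balanced phi: see hlift_pure.      *)
Definition hlift (V : zmodType) (phi : {mpoly k[n]} -> A -> V) (x : htens) : V :=
  fglift (fun p => phi p.1 p.2 : zmodule V) (repr x).

Definition balanced (V : zmodType) (phi : {mpoly k[n]} -> A -> V) : Prop :=
  [/\ forall f g a, phi (f + g) a = phi f a + phi g a,
      forall f a b, phi f (a + b) = phi f a + phi f b
    & forall f h a, phi (f * coprod n h) a = phi f (h *: a)].

Section Lift.
Variables (V : zmodType) (phi : {mpoly k[n]} -> A -> V).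
Hypothesis phiB : balanced phi.
Let F := fglift (fun p => phi p.1 p.2 : zmodule V).

Let F_sub : {morph F : x y / x - y}.
Proof. exact: lift_is_additive. Qed.

Let F_pure f a : F << (f, a) >> = phi f a.
Proof. by rewrite /F liftU scale1r. Qed.

Let F_hrel x : hrel x -> F x = 0.
Proof.
have [phiDl phiDr phiZ] := phiB.
elim=> [|{}x y _ Fx _ Fy|f g a|f a b|f h a].
- by rewrite -(subrr 0) F_sub subrr.
- by rewrite F_sub Fx Fy subrr.
- by rewrite !F_sub !F_pure phiDl addrAC addrK subrr.
- by rewrite !F_sub !F_pure phiDr addrAC addrK subrr.
- by rewrite F_sub !F_pure phiZ subrr.
Qed.

Let hlift_pi x : hlift phi (\pi_htens x) = F x.
Proof.
apply/eqP; rewrite -subr_eq0; apply/eqP.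
rewrite /hlift -/F -[LHS]F_sub; apply: F_hrel; apply/asboolP.
have: repr (\pi_htens x) - x \in hrelb by rewrite Quotient.idealrBE reprK.
by [].
Qed.

Lemma hlift_pure f a : hlift phi (hpure f a) = phi f a.
Proof. by rewrite hlift_pi F_pure. Qed.

Lemma hlift_sub : {morph hlift phi : x y / x - y}.
Proof.
move=> x y; rewrite -[x]reprK -[y]reprK.
by rewrite -[X in hlift _ X]raddfB /= !hlift_pi F_sub.
Qed.

End Lift.

Lemma hpure_balanced : balanced hpure.
Proof.
have hpi x y : hrel (x - y) -> \pi_htens x = \pi_htens y.
  by move=> /asboolP xy; apply/eqP; rewrite -Quotient.idealrBE.
split=> [f g a|f a b|f h a]; last by apply/hpi/hrelZ.
- rewrite -[RHS]raddfD /=; apply: hpi; rewrite opprD addrA; exact: hrelDl.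
- rewrite -[RHS]raddfD /=; apply: hpi; rewrite opprD addrA; exact: hrelDr.
Qed.

End TensorOverH.

Notation "f \oxH a" := (hpure f a) (at level 40, no associativity) : ring_scope.

Section Pseudoalgebras.
Variables (k : fieldType) (A : lmodType {poly k}).

(* f (x)_H a |-> F f (x)_H a *)
Definition hmap m n (F : {mpoly k[m]} -> {mpoly k[n]}) : htens m A -> htens n A :=
  hlift (fun f a => F f \oxH a).

Variable br : A -> A -> htens 2 A.

Definition is_pseudobracket : Prop :=
  [/\ forall a b c, br (a + b) c = br a c + br b c,
      forall a b c, br a (b + c) = br a b + br a c
    & forall h1 h2 a b,
        br (h1 *: a) (h2 *: b) = hmap (fun f => (h1 \ox h2) * f) (br a b)].

(* The extensions [x, d] and [d, x] of the bracket to x in the tensor product *)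
(* of {mpoly k[2]} and A; the maps lifted are balanced as soon as br is a     *)
(* pseudobracket.                                                             *)
Definition br_extl (x : htens 2 A) (d : A) : htens 3 A :=
  hlift (fun f c => hmap (fun g => tens1r f * coprod_id g) (br c d)) x.
Definition br_extr (d : A) (x : htens 2 A) : htens 3 A :=
  hlift (fun f c => hmap (fun g => tens1l f * id_coprod g) (br d c)) x.

Definition is_lie_pseudoalgebra : Prop :=
  [/\ is_pseudobracket,
      forall a b c, br_extl (br a b) c =
        br_extr a (br b c) - hmap (@swap12 k 1) (br_extr b (br a c))
    & forall a b, br a b = - hmap (@swap12 k 0) (br b a)].

End Pseudoalgebras.

Section SchrodingerVirasoro.
Variable k : fieldType.
Local Notation s := ('X : {poly k}).

Definition divpow n : {poly k} := (n`!%:R)^-1 *: 'X^n.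

Definition sv_alpha : {mpoly k[2]} := s \ox 1 - 1 \ox s.

Definition sv_beta (lam kap : k) : {mpoly k[2]} :=
  lam *: (s \ox 1) - 1 \ox s + kap *: (1 \ox 1).

Definition is_sv_alpha' (m : nat) (f : {mpoly k[2]}) : Prop :=
  if m is 0 then f = 0 else
  exists w : nat -> nat -> k,
    (exists2 i : nat, (i < m)%N & w i m != 0) /\
    f = \sum_(0 <= j < m.+1) \sum_(0 <= i < j)
          w i j *: (divpow i \ox divpow j - divpow j \ox divpow i).

Definition is_basis3 (L : lmodType {poly k}) (e0 e1 e2 : L) : Prop :=
  (forall x, exists h0 h1 h2 : {poly k}, x = h0 *: e0 + h1 *: e1 + h2 *: e2) /\
  (forall h0 h1 h2 : {poly k}, h0 *: e0 + h1 *: e1 + h2 *: e2 = 0 ->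
     [/\ h0 = 0, h1 = 0 & h2 = 0]).

(* br makes L, free with basis e0, e1, e2, an m-type Schroedinger-Virasoro    *)
(* Lie conformal algebra with the given structure constants.                  *)
Definition is_sv_algebra (m : nat) (L : lmodType {poly k}) (e0 e1 e2 : L)
    (lam1 kap1 lam2 kap2 : k) (alpha' eta : {mpoly k[2]})
    (br : L -> L -> htens 2 L) : Prop :=
  [/\ is_lie_pseudoalgebra br, is_sv_alpha' m alpha'
    & [/\ br e0 e0 = sv_alpha \oxH e0,
          br e0 e1 = sv_beta lam1 kap1 \oxH e1
            /\ br e0 e2 = sv_beta lam2 kap2 \oxH e2,
          br e1 e1 = alpha' \oxH e2,
          br e1 e2 = eta \oxH e2
        & br e2 e2 = 0]].

End SchrodingerVirasoro.

(* Main.v *)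
(* Expanding the Jacobi identity in the basis e_0, e_1, e_2 reduces the problem to
   polynomial identities in three variables for the triples (0,1,1), (0,1,2),
   (1,1,1) and (1,1,2), the other triples being permutations of these or
   automatic. The triples (1,1,2) and (0,1,2) force eta to be a constant a with
   a lambda_1 = a kappa_1 = 0. For (0,1,1), setting x = 0 gives
   kappa_2 = 2 kappa_1; the coefficients c(i,j) of alpha'(y + kappa_1, z + kappa_1)
   then satisfy a linear recursion, whose part of lowest degree in x makes this
   polynomial homogeneous of degree d = 2 lambda_1 - lambda_2, and whose other
   parts leave d <= 3 and the listed values of lambda_1. Finally (1,1,1) excludes
   a <> 0 in the case d = 3, lambda_1 = 0. *)
Require Import Defs.
From mathcomp Require Import all_boot all_algebra perm.
From mathcomp Require Import generic_quotient ring_quotient boolp.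
From mathcomp Require Import freeg mpoly.
From mathcomp Require Import ring zify.

Set Implicit Arguments.
Unset Strict Implicit.
Unset Printing Implicit Defensive.

Import GRing.Theory.
Local Open Scope ring_scope.

(** * Tensor products over H *)

(** The identities are stated for evaluation in an arbitrary commutative ring under [k]. One
    statement then serves three purposes: a variable can be set to 0, coefficients can be compared
    in an iterated polynomial ring, and the universal point (three independent variables) gives the
    Jacobi identity back for the converse. The shift by kappa_1 exposes homogeneity: once kappa_2 =
    2 kappa_1, it removes every constant from the (0,1,1) identity. For nonzero alpha' the recursion
    leaves four shapes, up to a scalar and the shift: y - z with lambda_1 free, y^2 - z^2, and two
    cubics. The number m is the largest exponent, not the degree: y^2 z - y z^2 has degree 3 but m =
    2. Together with alpha' = 0 this makes five families. A nonzero eta = a needs lambda_1 = kappa_1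
    = 0 and alpha'(u,v) + alpha'(v,w) = alpha'(u,w), which holds for the linear shape and fails for
    y^2 z - y z^2; in the two other shapes lambda_1 is not 0. *)

Section TensorTheory.
Variables (k : fieldType) (n : nat) (A : lmodType {poly k}).
Implicit Types (f g : {mpoly k[n]}) (a b : A).

Lemma hpureDl f g a : (f + g) \oxH a = f \oxH a + g \oxH a.
Proof. by case: (hpure_balanced n A). Qed.

Lemma hpureDr f a b : f \oxH (a + b) = f \oxH a + f \oxH b.
Proof. by case: (hpure_balanced n A). Qed.

Lemma hpureZ f h a : (f * coprod n h) \oxH a = f \oxH (h *: a).
Proof. by case: (hpure_balanced n A). Qed.

Lemma hpure0l a : (0 : {mpoly k[n]}) \oxH a = 0.
Proof. by apply: (addrI ((0 : {mpoly k[n]}) \oxH a)); rewrite -hpureDl !addr0. Qed.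

Lemma hpureNl f a : (- f) \oxH a = - (f \oxH a).
Proof.
by apply: (addrI (f \oxH a)); rewrite -hpureDl !subrr hpure0l.
Qed.

Lemma hpureBl f g a : (f - g) \oxH a = f \oxH a - g \oxH a.
Proof. by rewrite hpureDl hpureNl. Qed.

(** Every class is represented by a formal integer combination of pairs, so closure under
    differences reaches all of them from the pure tensors. *)
Lemma htens_ind (P : htens n A -> Prop) :
  P 0 -> (forall x y, P x -> P y -> P (x - y)) ->
  (forall f a, P (f \oxH a)) -> forall x, P x.
Proof.
move=> P0 PB Pp x.
have PN y : P y -> P (- y) by move=> Py; rewrite -sub0r; apply: PB.
have PD y z : P y -> P z -> P (y + z).
  by move=> Py Pz; rewrite -[z]opprK; apply: PB => //; apply: PN.
rewrite -[x]reprK; elim/freeg_ind_dom0: (repr x) => [|c [f a] D _ _ IH]; rewrite ?raddf0 //.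
rewrite raddfD /=; apply: (PD) => //.
have -> : << c *g (f, a) >> = << (f, a) >> *~ c :> {freeg ({mpoly k[n]} * A)%type}.
  by rewrite freegU_mulz intz.
rewrite raddfMz /= -/(hpure f a).
have PM m : P ((f \oxH a) *+ m).
  by elim: m => [|m IHm]; rewrite ?mulr0n // mulrS; apply: (PD).
case: c => m; first exact: PM.
rewrite NegzE mulrNz; apply: PN; exact: PM.
Qed.

End TensorTheory.

(** * The coproduct under substitutions and permutations of tensor factors *)

Section CoproductMaps.
Variable k : fieldType.
Implicit Type h : {poly k}.

Local Notation x_ i := ('X_(i%R : 'I_3) : {mpoly k[3]}).

Lemma comp_hornerC m n (h : {poly k}) (u : {mpoly k[m]}) (lq : m.-tuple {mpoly k[n]}) :
  (map_poly (@mpolyC m k) h).[u] \mPo lq = (map_poly (@mpolyC n k) h).[u \mPo lq].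
Proof.
rewrite -(horner_map (comp_mpoly lq)) -map_poly_comp.
by congr _.[_]; apply: eq_map_poly => c /=; rewrite comp_mpolyC.
Qed.

Lemma sumX2 : \sum_(i < 2) 'X_i = 'X_0 + 'X_1 :> {mpoly k[2]}.
Proof.
by rewrite big_ord_recr big_ord1 /=; congr (mpolyX _ U_(_) + mpolyX _ U_(_)); apply/val_inj.
Qed.

Lemma sumX3 : \sum_(i < 3) 'X_i = x_ 0 + x_ 1 + x_ 2.
Proof.
rewrite big_ord_recr big_ord_recr big_ord1 /=.
by congr (mpolyX _ U_(_) + mpolyX _ U_(_) + mpolyX _ U_(_)); apply/val_inj.
Qed.

Lemma comp2X0 n (u v : {mpoly k[n]}) : ('X_0 : {mpoly k[2]}) \mPo [tuple u; v] = u.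
Proof. by rewrite comp_mpolyXU. Qed.

Lemma comp2X1 n (u v : {mpoly k[n]}) : ('X_1 : {mpoly k[2]}) \mPo [tuple u; v] = v.
Proof. by rewrite comp_mpolyXU. Qed.

Lemma comp2_slot0 n h (u v : {mpoly k[n]}) :
  slot (0 : 'I_2) h \mPo [tuple u; v] = (map_poly (@mpolyC n k) h).[u].
Proof. by rewrite comp_hornerC comp2X0. Qed.

Lemma comp2_slot1 n h (u v : {mpoly k[n]}) :
  slot (1 : 'I_2) h \mPo [tuple u; v] = (map_poly (@mpolyC n k) h).[v].
Proof. by rewrite comp_hornerC comp2X1. Qed.

Lemma comp2_coprod n h (u v : {mpoly k[n]}) :
  coprod 2 h \mPo [tuple u; v] = (map_poly (@mpolyC n k) h).[u + v].
Proof. by rewrite comp_hornerC sumX2 comp_mpolyD comp2X0 comp2X1. Qed.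

Lemma coprod_id_coprod h : coprod_id (coprod 2 h) = coprod 3 h.
Proof. by rewrite /coprod_id comp2_coprod /coprod sumX3. Qed.

Lemma id_coprod_coprod h : id_coprod (coprod 2 h) = coprod 3 h.
Proof. by rewrite /id_coprod comp2_coprod /coprod sumX3 addrA. Qed.

Lemma coprod_id_slot0 h : coprod_id (slot 0 h) = tens1r (coprod 2 h).
Proof. by rewrite /coprod_id /tens1r comp2_slot0 comp2_coprod. Qed.

Lemma id_coprod_slot1 h : id_coprod (slot 1 h) = tens1l (coprod 2 h).
Proof. by rewrite /id_coprod /tens1l comp2_slot1 comp2_coprod. Qed.

Lemma msym_hornerC n (s : {perm 'I_n}) h (u : {mpoly k[n]}) :
  msym s (map_poly (@mpolyC n k) h).[u] = (map_poly (@mpolyC n k) h).[msym s u].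
Proof.
rewrite -(horner_map (msym s)) -map_poly_comp.
congr _.[_]; apply: eq_map_poly => c /=.
by rewrite /msym mmapC.
Qed.

Lemma msymX1 n (s : {perm 'I_n}) (i : 'I_n) : msym s 'X_i = 'X_(s i) :> {mpoly k[n]}.
Proof.
by rewrite /msym mmapX mmap1U.
Qed.

Lemma msym_coprod n (s : {perm 'I_n}) h : msym s (coprod n h) = coprod n h.
Proof.
rewrite /coprod msym_hornerC; congr _.[_].
rewrite raddf_sum /= [RHS](reindex_inj (@perm_inj _ s)) /=.
by apply: eq_bigr => i _; rewrite msymX1.
Qed.

Lemma tens11 : 1 \ox 1 = 1 :> {mpoly k[2]}.
Proof. by rewrite /tens /slot !rmorph1 !hornerC mulr1. Qed.

Lemma slotM n (i : 'I_n) h1 h2 : slot i (h1 * h2) = slot i h1 * slot i h2.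
Proof. by rewrite /slot rmorphM hornerM. Qed.

Lemma slotD n (i : 'I_n) h1 h2 : slot i (h1 + h2) = slot i h1 + slot i h2.
Proof. by rewrite /slot rmorphD hornerD. Qed.

Lemma slot1 n (i : 'I_n) : slot i 1 = 1 :> {mpoly k[n]}.
Proof. by rewrite /slot rmorph1 hornerC. Qed.

Lemma tens1r_tens h1 h2 : tens1r (h1 \ox h2) = slot 0 h1 * slot 1 h2.
Proof. by rewrite /tens1r rmorphM /= comp2_slot0 comp2_slot1. Qed.

Lemma tens1l_tens h1 h2 : tens1l (h1 \ox h2) = slot 1 h1 * slot 2 h2.
Proof. by rewrite /tens1l rmorphM /= comp2_slot0 comp2_slot1. Qed.

Lemma coprod_id_slot1 h : coprod_id (slot 1 h) = slot 2 h.
Proof. by rewrite /coprod_id comp2_slot1. Qed.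

Lemma id_coprod_slot0 h : id_coprod (slot 0 h) = slot 0 h.
Proof. by rewrite /id_coprod comp2_slot0. Qed.

End CoproductMaps.

(** * Induced maps on tensor products over H, and the extended brackets *)

Section Hmap.
Variables (k : fieldType) (A : lmodType {poly k}).

(** Additivity and right [H]-linearity: the conditions under which [hmap F], computed on a chosen
    representative, is well defined. *)
Definition coprod_linear m n (F : {mpoly k[m]} -> {mpoly k[n]}) : Prop :=
  (forall f g, F (f + g) = F f + F g) /\
  (forall f h, F (f * coprod m h) = F f * coprod n h).

Lemma coprod_linear_mul m n (F : {mpoly k[m]} -> {mpoly k[n]}) g :
  coprod_linear F -> coprod_linear (fun f => g * F f).
Proof. by case=> FD FZ; split=> [f f'|f h]; rewrite ?FD ?mulrDr ?FZ ?mulrA. Qed.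

Lemma coprod_linear_id n : coprod_linear (@id {mpoly k[n]}).
Proof. by split. Qed.

Lemma coprod_linear_swap12 n : coprod_linear (@swap12 k n).
Proof.
by split=> [f g|f h]; rewrite /swap12 ?rmorphD ?rmorphM //= msym_coprod.
Qed.

Lemma coprod_linear_coprod_id : coprod_linear (@coprod_id k).
Proof.
split=> [f g|f h]; first by rewrite /coprod_id rmorphD.
by rewrite -coprod_id_coprod /coprod_id -rmorphM.
Qed.

Lemma coprod_linear_id_coprod : coprod_linear (@id_coprod k).
Proof.
split=> [f g|f h]; first by rewrite /id_coprod rmorphD.
by rewrite -id_coprod_coprod /id_coprod -rmorphM.
Qed.

Section Semilinear.
Variables (m n : nat) (F : {mpoly k[m]} -> {mpoly k[n]}).
Hypothesis F_lin : coprod_linear F.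

Lemma balanced_hmap : balanced (fun f (a : A) => F f \oxH a).
Proof.
have [FD FZ] := F_lin.
by split=> *; rewrite ?FD ?FZ ?hpureDl ?hpureDr ?hpureZ.
Qed.

Lemma hmap_pure f (a : A) : hmap F (f \oxH a) = F f \oxH a.
Proof. exact: (hlift_pure balanced_hmap). Qed.

Lemma hmapB (x y : htens m A) : hmap F (x - y) = hmap F x - hmap F y.
Proof. exact: (hlift_sub balanced_hmap). Qed.

Lemma hmap0 : hmap F (0 : htens m A) = 0.
Proof. by rewrite -[X in hmap _ X](subrr 0) hmapB subrr. Qed.

Lemma hmapN (x : htens m A) : hmap F (- x) = - hmap F x.
Proof. by rewrite -[in LHS](sub0r x) hmapB hmap0 sub0r. Qed.

Lemma hmapD (x y : htens m A) : hmap F (x + y) = hmap F x + hmap F y.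
Proof. by rewrite -[in LHS](opprK y) hmapB hmapN opprK. Qed.

End Semilinear.

Variable br : A -> A -> htens 2 A.
Hypothesis br_psb : is_pseudobracket br.

Lemma pbrDl a b c : br (a + b) c = br a c + br b c.
Proof. by case: br_psb. Qed.

Lemma pbrDr a b c : br a (b + c) = br a b + br a c.
Proof. by case: br_psb. Qed.

Lemma pbr_pure h1 h2 a b c f : br a b = f \oxH c ->
  br (h1 *: a) (h2 *: b) = ((h1 \ox h2) * f) \oxH c.
Proof.
move=> br_ab; case: br_psb => _ _ ->; rewrite br_ab hmap_pure //.
by apply: coprod_linear_mul; apply: coprod_linear_id.
Qed.

Lemma coprod_linear_extl (f : {mpoly k[2]}) :
  coprod_linear (fun g => tens1r f * coprod_id g).
Proof. exact/coprod_linear_mul/coprod_linear_coprod_id. Qed.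

Lemma coprod_linear_extr (f : {mpoly k[2]}) :
  coprod_linear (fun g => tens1l f * id_coprod g).
Proof. exact/coprod_linear_mul/coprod_linear_id_coprod. Qed.

Lemma hmap_eqD m n (F1 F2 F : {mpoly k[m]} -> {mpoly k[n]}) (x : htens m A) :
  coprod_linear F1 -> coprod_linear F2 -> coprod_linear F ->
  (forall f, F f = F1 f + F2 f) -> hmap F x = hmap F1 x + hmap F2 x.
Proof.
move=> l1 l2 l FE; elim/htens_ind: x => [|x y IHx IHy|f a].
- by rewrite !hmap0 // addr0.
- by rewrite !hmapB // IHx IHy addrACA opprD.
- by rewrite !hmap_pure // FE hpureDl.
Qed.

Lemma hmap_eq_comp l m n (G : {mpoly k[l]} -> {mpoly k[m]})
    (F : {mpoly k[m]} -> {mpoly k[n]}) (K : {mpoly k[l]} -> {mpoly k[n]})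
    (x : htens l A) :
  coprod_linear F -> coprod_linear G -> coprod_linear K ->
  (forall f, K f = F (G f)) -> hmap K x = hmap F (hmap G x).
Proof.
move=> lF lG lK KE; elim/htens_ind: x => [|x y IHx IHy|f a].
- by rewrite !hmap0.
- by rewrite !hmapB // IHx IHy.
- by rewrite !hmap_pure // KE.
Qed.

(** A factor [h] moves across the tensor sign because Delta (x) id sends h (x) 1 to Delta(h) (x) 1,
    which is absorbed into the factor coming from [f]. *)
Lemma balanced_extl d : balanced
  (fun f c => hmap (fun g => tens1r f * coprod_id g) (br c d)).
Proof.
split=> [f g a|f a b|f h a].
- apply: hmap_eqD => [|||p]; try exact: coprod_linear_extl.
  by rewrite /tens1r rmorphD mulrDl.
- by rewrite pbrDl hmapD //; apply: coprod_linear_extl.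
- case: br_psb => _ _ brZ; rewrite -[d in RHS]scale1r brZ.
  apply: hmap_eq_comp => [|||p]; try exact: coprod_linear_extl.
    by apply: coprod_linear_mul; apply: coprod_linear_id.
  rewrite {2}/coprod_id rmorphM /= -/(coprod_id _) -/(coprod_id _).
  rewrite /tens slot1 mulr1 coprod_id_slot0.
  by rewrite [tens1r (_ * _)]rmorphM /= mulrA.
Qed.

Lemma balanced_extr d : balanced
  (fun f c => hmap (fun g => tens1l f * id_coprod g) (br d c)).
Proof.
split=> [f g a|f a b|f h a].
- apply: hmap_eqD => [|||p]; try exact: coprod_linear_extr.
  by rewrite /tens1l rmorphD mulrDl.
- by rewrite pbrDr hmapD //; apply: coprod_linear_extr.
- case: br_psb => _ _ brZ; rewrite -[d in RHS]scale1r brZ.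
  apply: hmap_eq_comp => [|||p]; try exact: coprod_linear_extr.
    by apply: coprod_linear_mul; apply: coprod_linear_id.
  rewrite {2}/id_coprod rmorphM /= -/(id_coprod _) -/(id_coprod _).
  rewrite /tens slot1 mul1r id_coprod_slot1.
  by rewrite [tens1l (_ * _)]rmorphM /= mulrA.
Qed.

Lemma br_extl_pure f a d g c : br a d = g \oxH c ->
  br_extl br (f \oxH a) d = (tens1r f * coprod_id g) \oxH c.
Proof.
move=> br_ad; rewrite /br_extl (hlift_pure (balanced_extl d)) br_ad.
by rewrite hmap_pure //; apply: coprod_linear_extl.
Qed.

Lemma br_extr_pure f a d g c : br d a = g \oxH c ->
  br_extr br d (f \oxH a) = (tens1l f * id_coprod g) \oxH c.
Proof.
move=> br_da; rewrite /br_extr (hlift_pure (balanced_extr d)) br_da.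
by rewrite hmap_pure //; apply: coprod_linear_extr.
Qed.

Lemma br_extlB x y d : br_extl br (x - y) d = br_extl br x d - br_extl br y d.
Proof. exact: (hlift_sub (balanced_extl d)). Qed.

Lemma br_extrB x y d : br_extr br d (x - y) = br_extr br d x - br_extr br d y.
Proof. exact: (hlift_sub (balanced_extr d)). Qed.

Lemma br_extl0 d : br_extl br 0 d = 0.
Proof. by rewrite -[X in br_extl _ X](subrr 0) br_extlB subrr. Qed.

Lemma br_extr0 d : br_extr br d 0 = 0.
Proof. by rewrite -[X in br_extr _ _ X](subrr 0) br_extrB subrr. Qed.

Lemma br_extlD x y d : br_extl br (x + y) d = br_extl br x d + br_extl br y d.
Proof.
have N z : br_extl br (- z) d = - br_extl br z d.
  by rewrite -[in LHS](sub0r z) br_extlB br_extl0 sub0r.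
by rewrite -[in LHS](opprK y) br_extlB N opprK.
Qed.

Lemma br_extrD x y d : br_extr br d (x + y) = br_extr br d x + br_extr br d y.
Proof.
have N z : br_extr br d (- z) = - br_extr br d z.
  by rewrite -[in LHS](sub0r z) br_extrB br_extr0 sub0r.
by rewrite -[in LHS](opprK y) br_extrB N opprK.
Qed.

Lemma br_extl_Dr x d d' : br_extl br x (d + d') = br_extl br x d + br_extl br x d'.
Proof.
elim/htens_ind: x => [|x y IHx IHy|f a]; first by rewrite !br_extl0 addr0.
  by rewrite !br_extlB IHx IHy addrACA opprD.
rewrite /br_extl !(hlift_pure (balanced_extl _)) pbrDr hmapD //.
exact: coprod_linear_extl.
Qed.

Lemma br_extr_Dl x d d' : br_extr br (d + d') x = br_extr br d x + br_extr br d' x.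
Proof.
elim/htens_ind: x => [|x y IHx IHy|f a]; first by rewrite !br_extr0 addr0.
  by rewrite !br_extrB IHx IHy addrACA opprD.
rewrite /br_extr !(hlift_pure (balanced_extr _)) pbrDl hmapD //.
exact: coprod_linear_extr.
Qed.

End Hmap.

(** * Lie pseudoalgebras from structure constants *)

Section StructureConstants.
Variables (k : fieldType) (L : lmodType {poly k}) (e0 e1 e2 : L).
Hypothesis basis_e : is_basis3 e0 e1 e2.

Definition bas (i : nat) : L := nth 0 [:: e0; e1; e2] i.

(** The basis property only asserts that coordinates exist, so they are picked by choice; linearity
    then follows from their uniqueness. *)
Lemma coord_exists : exists co : nat -> L -> {poly k},
  [/\ forall i a b, co i (a + b) = co i a + co i b,
      forall i h a, co i (h *: a) = h * co i a,
      forall i, (i < 3)%N -> co i (bas i) = 1,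
      forall i j, (i < 3)%N -> (j < 3)%N -> i != j -> co i (bas j) = 0
    & forall x, x = \sum_(i < 3) co i x *: bas i].
Proof.
have [span free] := basis_e.
have /choice[c cE] x : exists c : nat -> {poly k}, x = \sum_(i < 3) c i *: bas i.
  have [h0 [h1 [h2 ->]]] := span x; exists (nth 0 [:: h0; h1; h2]).
  by rewrite !big_ord_recr big_ord0 /= add0r.
have uniq_c (c1 c2 : nat -> {poly k}) : \sum_(i < 3) c1 i *: bas i = \sum_(i < 3) c2 i *: bas i ->
    forall i, (i < 3)%N -> c1 i = c2 i.
  move/eqP; rewrite -subr_eq0 -sumrB !big_ord_recr big_ord0 /= add0r -!scalerBl.
  move/eqP=> /free[/eqP h0 /eqP h1 /eqP h2].
  by do 3?[case=> [_|]] => //; apply/eqP; rewrite -subr_eq0.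
(* The chosen function is arbitrary beyond index 2; cutting it off there makes linearity hold for
   every [i]. *)
pose co i x := if (i < 3)%N then c x i else 0.
have coE x : x = \sum_(i < 3) co i x *: bas i.
  by rewrite {1}[x]cE; apply: eq_bigr => i _; rewrite /co ltn_ord.
have uniq_co (d : nat -> {poly k}) x : x = \sum_(i < 3) d i *: bas i ->
    forall i, (i < 3)%N -> co i x = d i.
  by move=> xE; apply: uniq_c; rewrite -coE.
have co_bas j : (j < 3)%N -> forall i, (i < 3)%N -> co i (bas j) = (i == j)%:R.
  move=> lt_j; apply: (uniq_co (fun i => (i == j)%:R)).
  rewrite (bigD1 (Ordinal lt_j)) //= eqxx scale1r big1 ?addr0 // => i ne_ij.
  by rewrite -[_ == _]/(i == Ordinal lt_j) (negPf ne_ij) scale0r.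
exists co; split=> [i a b|i h a|i lt_i|i j lt_i lt_j ne_ij|//].
- have [lt_i|ge_i] := ltnP i 3; last by rewrite /co ltnNge ge_i addr0.
  apply: (uniq_co (fun i => co i a + co i b)) => //.
  rewrite [a in LHS]coE [b in LHS]coE -big_split.
  by apply: eq_bigr => j _; rewrite scalerDl.
- have [lt_i|ge_i] := ltnP i 3; last by rewrite /co ltnNge ge_i mulr0.
  apply: (uniq_co (fun i => h * co i a)) => //.
  rewrite [a in LHS]coE scaler_sumr.
  by apply: eq_bigr => j _; rewrite scalerA.
- by rewrite co_bas // eqxx.
- by rewrite co_bas // (negPf ne_ij).
Qed.

Lemma bas_ind (P : L -> Prop) :
  (forall a b, P a -> P b -> P (a + b)) ->
  (forall i h, (i < 3)%N -> P (h *: bas i)) -> forall x, P x.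
Proof.
move=> PD Pb x; have [span _] := basis_e.
have [h0 [h1 [h2 ->]]] := span x.
apply: (PD); last exact: (Pb 2%N).
by apply: (PD); [exact: (Pb 0%N)|exact: (Pb 1%N)].
Qed.

(** The map sending f (x)_H a to [f * coprod n (co i a)] is balanced and recovers [f] at the basis
    vector, so identities in the tensor product become polynomial ones. *)
Lemma hpure_bas_inj n i (f g : {mpoly k[n]}) :
  (i < 3)%N -> f \oxH bas i = g \oxH bas i -> f = g.
Proof.
move=> lt_i; have [co [coD coZ co1 _ _]] := coord_exists.
have bal : balanced (fun (f : {mpoly k[n]}) a => f * coprod n (co i a)).
  split=> [f' g' a|f' a b|f' h a]; first by rewrite mulrDl.
    by rewrite coD /coprod rmorphD hornerD mulrDr.
  by rewrite coZ {3}/coprod rmorphM hornerM mulrA.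
move/(congr1 (hlift (fun (f : {mpoly k[n]}) a => f * coprod n (co i a)))).
by rewrite !(hlift_pure bal) co1 // /coprod rmorph1 hornerC !mulr1.
Qed.

(* The bracket of [e_i] and [e_j] is a multiple of [e_(min (i + j, 2))]. *)
Definition tgt (i j : nat) : nat := minn (i + j) 2.

Lemma tgt_lt i j : (tgt i j < 3)%N.
Proof. by rewrite ltnS geq_minr. Qed.

Lemma tgtC i j : tgt i j = tgt j i.
Proof. by rewrite /tgt addnC. Qed.

(** With commutativity, this puts all three terms of the Jacobi identity at a basis triple on the
    same basis vector, so a single coefficient has to be compared. *)
Lemma tgtA i j l : tgt (tgt i j) l = tgt i (tgt j l).
Proof. by rewrite /tgt; lia. Qed.

Variable F : nat -> nat -> {mpoly k[2]}.

Definition jacobi_at i j l : Prop :=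
  tens1r (F i j) * coprod_id (F (tgt i j) l) =
  tens1l (F j l) * id_coprod (F i (tgt j l)) -
    swap12 (tens1l (F i l) * id_coprod (F j (tgt i l))).

Definition has_constants (br : L -> L -> htens 2 L) : Prop :=
  forall i j, (i < 3)%N -> (j < 3)%N -> br (bas i) (bas j) = F i j \oxH bas (tgt i j).

Lemma swap12_slot n (i : 'I_n.+2) (h : {poly k}) :
  swap12 (slot i h) = slot (tperm 0 1 i) h.
Proof. by rewrite /swap12 /slot msym_hornerC msymX1. Qed.

Lemma swap12M n (f g : {mpoly k[n.+2]}) : swap12 (f * g) = swap12 f * swap12 g.
Proof. by rewrite /swap12 rmorphM. Qed.

Section Jacobi.
Variable br : L -> L -> htens 2 L.
Hypotheses (br_psb : is_pseudobracket br) (brF : has_constants br).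

Lemma br_basZ i j h1 h2 : (i < 3)%N -> (j < 3)%N ->
  br (h1 *: bas i) (h2 *: bas j) = ((h1 \ox h2) * F i j) \oxH bas (tgt i j).
Proof. by move=> lt_i lt_j; apply: pbr_pure; rewrite ?brF. Qed.

Section Triple.
Variables (i j l : nat) (h1 h2 h3 : {poly k}).
Hypotheses (lt_i : (i < 3)%N) (lt_j : (j < 3)%N) (lt_l : (l < 3)%N).

Let h123 : {mpoly k[3]} := slot 0 h1 * slot 1 h2 * slot 2 h3.

Lemma br_extl_bas :
  br_extl br (br (h1 *: bas i) (h2 *: bas j)) (h3 *: bas l) =
  (h123 * (tens1r (F i j) * coprod_id (F (tgt i j) l))) \oxH bas (tgt i (tgt j l)).
Proof.
rewrite br_basZ // (br_extl_pure br_psb _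
  (g := (1 \ox h3) * F (tgt i j) l) (c := bas (tgt (tgt i j) l))); last first.
  by rewrite -[X in br X]scale1r br_basZ ?tgt_lt.
rewrite tgtA; congr (_ \oxH _).
rewrite /tens1r rmorphM /= -!/(tens1r _) tens1r_tens.
rewrite /coprod_id rmorphM /= -!/(coprod_id _) /tens slot1 mul1r coprod_id_slot1.
by rewrite /h123 mulrACA.
Qed.

Lemma br_extr_bas :
  br_extr br (h1 *: bas i) (br (h2 *: bas j) (h3 *: bas l)) =
  (h123 * (tens1l (F j l) * id_coprod (F i (tgt j l)))) \oxH bas (tgt i (tgt j l)).
Proof.
rewrite br_basZ // (br_extr_pure br_psb _
  (g := (h1 \ox 1) * F i (tgt j l)) (c := bas (tgt i (tgt j l)))); last first.
  by rewrite -[X in br _ X]scale1r br_basZ ?tgt_lt.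
congr (_ \oxH _).
rewrite /tens1l rmorphM /= -!/(tens1l _) tens1l_tens.
rewrite /id_coprod rmorphM /= -!/(id_coprod _) /tens slot1 mulr1 id_coprod_slot0.
by rewrite mulrACA /h123; congr (_ * _); rewrite mulrC mulrA.
Qed.

End Triple.

Lemma swap12_h123 (h1 h2 h3 : {poly k}) :
  swap12 (slot 0 h2 * slot 1 h1 * slot 2 h3 : {mpoly k[3]}) =
  slot 0 h1 * slot 1 h2 * slot 2 h3.
Proof.
rewrite !swap12M !swap12_slot tpermL tpermR tpermD // [X in X * _]mulrC //.
Qed.

Lemma jacobi_bas i j l (h1 h2 h3 : {poly k}) :
  (i < 3)%N -> (j < 3)%N -> (l < 3)%N -> jacobi_at i j l ->
  let a := h1 *: bas i in let b := h2 *: bas j in let c := h3 *: bas l in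
  br_extl br (br a b) c =
    br_extr br a (br b c) - hmap (@swap12 k 1) (br_extr br b (br a c)).
Proof.
move=> lt_i lt_j lt_l J /=; rewrite br_extl_bas // !br_extr_bas //.
rewrite hmap_pure; last exact: coprod_linear_swap12.
rewrite -(tgtA j) (tgtC j i) tgtA -hpureBl swap12M swap12_h123 -mulrBr.
by rewrite -J.
Qed.

(** Both axioms are additive in each argument, which reduces them to multiples of basis vectors; the
    multipliers then factor out as h1 (x) h2 (x) h3. *)
Lemma lie_of_constants :
  (forall i j l, (i < 3)%N -> (j < 3)%N -> (l < 3)%N -> jacobi_at i j l) ->
  (forall i j, (i < 3)%N -> (j < 3)%N -> F i j = - swap12 (F j i)) ->
  is_lie_pseudoalgebra br.
Proof.
move=> J S; split=> // [a b c|a b].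
- elim/bas_ind: a => [a a' IH IH'|i h1 lt_i].
    rewrite (pbrDl br_psb) br_extlD // IH IH' br_extr_Dl // (pbrDl br_psb) br_extrD //.
    by rewrite hmapD ?opprD 1?addrACA //; apply: coprod_linear_swap12.
  elim/bas_ind: b => [b b' IH IH'|j h2 lt_j].
    rewrite (pbrDr br_psb) br_extlD // IH IH' br_extr_Dl // (pbrDl br_psb) br_extrD //.
    by rewrite hmapD ?opprD 1?addrACA //; apply: coprod_linear_swap12.
  elim/bas_ind: c => [c c' IH IH'|l h3 lt_l]; last by apply: jacobi_bas; auto.
  rewrite br_extl_Dr // IH IH' !(pbrDr br_psb) !br_extrD //.
  by rewrite hmapD ?opprD 1?addrACA //; apply: coprod_linear_swap12.
- elim/bas_ind: a => [a a' IH IH'|i h1 lt_i].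
    rewrite (pbrDl br_psb) IH IH' (pbrDr br_psb) hmapD ?opprD //.
    exact: coprod_linear_swap12.
  elim/bas_ind: b => [b b' IH IH'|j h2 lt_j].
    rewrite (pbrDr br_psb) IH IH' (pbrDl br_psb) hmapD ?opprD //.
    exact: coprod_linear_swap12.
  rewrite !br_basZ // hmap_pure; last exact: coprod_linear_swap12.
  rewrite tgtC -hpureNl; congr (_ \oxH _).
  rewrite swap12M /tens swap12M !swap12_slot tpermL tpermR [X in X * _]mulrC.
  by rewrite -mulrN -S.
Qed.

Lemma jacobi_of_lie : is_lie_pseudoalgebra br ->
  forall i j l, (i < 3)%N -> (j < 3)%N -> (l < 3)%N -> jacobi_at i j l.
Proof.
case=> _ J _ i j l lt_i lt_j lt_l.
apply: (hpure_bas_inj (tgt_lt i (tgt j l))).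
have := J (1 *: bas i) (1 *: bas j) (1 *: bas l).
rewrite br_extl_bas // !br_extr_bas //.
rewrite hmap_pure; last exact: coprod_linear_swap12.
by rewrite -(tgtA j) (tgtC j i) tgtA -hpureBl !slot1 !mul1r.
Qed.

End Jacobi.

(** By freeness any table of constants is realised, whatever its symmetry; the converse direction
    therefore has only identities left to check. *)
Lemma bracket_exists : exists2 br, is_pseudobracket br & has_constants br.
Proof.
have [co [coD coZ co1 co0 _]] := coord_exists.
have tensDl h1 h1' h2 : (h1 + h1') \ox h2 = h1 \ox h2 + h1' \ox h2 :> {mpoly k[2]}.
  by rewrite /tens slotD mulrDl.
have tensDr h1 h2 h2' : h1 \ox (h2 + h2') = h1 \ox h2 + h1 \ox h2' :> {mpoly k[2]}.
  by rewrite /tens slotD mulrDr.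
have tensM h1 h1' h2 h2' : (h1 * h1') \ox (h2 * h2') = (h1 \ox h2) * (h1' \ox h2') :> {mpoly k[2]}.
  by rewrite /tens !slotM mulrACA.
exists (fun a b => \sum_(i < 3) \sum_(j < 3)
  ((co i a \ox co j b) * F i j) \oxH bas (tgt i j)).
- split=> [a b c|a b c|h1 h2 a b].
  + rewrite -big_split; apply: eq_bigr => i _; rewrite -big_split.
    by apply: eq_bigr => j _; rewrite coD tensDl mulrDl hpureDl.
  + rewrite -big_split; apply: eq_bigr => i _; rewrite -big_split.
    by apply: eq_bigr => j _; rewrite coD tensDr mulrDl hpureDl.
  + have lin : coprod_linear (fun f : {mpoly k[2]} => (h1 \ox h2) * f).
      by apply: coprod_linear_mul; apply: coprod_linear_id.
    rewrite (big_morph _ (hmapD lin) (hmap0 _ lin)); apply: eq_bigr => i _.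
    rewrite (big_morph _ (hmapD lin) (hmap0 _ lin)); apply: eq_bigr => j _.
    by rewrite hmap_pure // !coZ tensM mulrA.
- move=> i j lt_i lt_j.
  have t0l h : 0 \ox h = 0 :> {mpoly k[2]} by rewrite /tens /slot rmorph0 horner0 mul0r.
  have t0r h : h \ox 0 = 0 :> {mpoly k[2]} by rewrite /tens /slot rmorph0 horner0 mulr0.
  rewrite (bigD1 (Ordinal lt_i)) //= [X in _ + X]big1 ?addr0 => [|i' ne_i]; last first.
    by apply: big1 => j' _; rewrite (co0 i' i) // t0l mul0r hpure0l.
  rewrite (bigD1 (Ordinal lt_j)) //= [X in _ + X]big1 ?addr0 => [|j' ne_j]; last first.
    by rewrite (co0 j' j) // t0r mul0r hpure0l.
  by rewrite !co1 // tens11 mul1r.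
Qed.

End StructureConstants.

(** * The Jacobi identity as a polynomial identity *)

Section Evaluation.
Variables (k : fieldType) (V : comNzRingType) (h : {rmorphism k -> V}).
Implicit Types (u v w : V) (f g : {mpoly k[2]}).

(** The target ring is left open: it is {mpoly k[2]} for specialisations, {mpoly k[3]} for the
    universal identity, and an iterated polynomial ring for extracting coefficients. *)
Definition ev u v : {mpoly k[2]} -> V := mmap h (tnth [tuple u; v]).

Lemma ev0 u v : ev u v 0 = 0. Proof. exact: rmorph0. Qed.
Lemma ev1 u v : ev u v 1 = 1. Proof. exact: rmorph1. Qed.
Lemma evD u v f g : ev u v (f + g) = ev u v f + ev u v g. Proof. exact: rmorphD. Qed.
Lemma evN u v f : ev u v (- f) = - ev u v f. Proof. exact: rmorphN. Qed.
Lemma evB u v f g : ev u v (f - g) = ev u v f - ev u v g. Proof. exact: rmorphB. Qed.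
Lemma evM u v f g : ev u v (f * g) = ev u v f * ev u v g. Proof. exact: rmorphM. Qed.
Lemma evXn u v f n : ev u v (f ^+ n) = ev u v f ^+ n. Proof. exact: rmorphXn. Qed.
Lemma evZ u v c f : ev u v (c *: f) = h c * ev u v f. Proof. exact: mmapZ. Qed.
Lemma evX0 u v : ev u v 'X_0 = u. Proof. by rewrite /ev mmapX mmap1U. Qed.
Lemma evX1 u v : ev u v 'X_1 = v. Proof. by rewrite /ev mmapX mmap1U. Qed.

Lemma mmap_comp m n (g : 'I_n -> V) (lq : m.-tuple {mpoly k[n]}) (f : {mpoly k[m]}) :
  mmap h g (f \mPo lq) = mmap h (fun i => mmap h g (tnth lq i)) f.
Proof.
rewrite comp_mpolyEX [X in _ = mmap _ _ X](mpolyE f) !raddf_sum /=.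
apply: eq_bigr => M _; rewrite !mmapZ mmapX comp_mpolyX rmorph_prod /mmap1.
by congr (_ * _); apply: eq_bigr => i _; rewrite rmorphXn.
Qed.

Lemma mmap_comp2 n (g : 'I_n -> V) (p q : {mpoly k[n]}) f :
  mmap h g (f \mPo [tuple p; q]) = ev (mmap h g p) (mmap h g q) f.
Proof.
rewrite mmap_comp /ev; apply: eq_bigr => M _; congr (_ * _).
by apply: mmap1_eq => -[[|[|//]] lt_i] /=; rewrite !(tnth_nth 0).
Qed.

Lemma swap12E f : swap12 f = f \mPo [tuple 'X_1; 'X_0].
Proof.
rewrite /swap12 /msym /comp_mpoly; apply: eq_bigr => M _; congr (_ * _).
apply: mmap1_eq => -[[|[|//]] lt_i] /=; rewrite !(tnth_nth 0) /=.
  by rewrite (_ : Ordinal _ = 0) ?tpermL //; apply/val_inj.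
by rewrite (_ : Ordinal _ = 1) ?tpermR //; apply/val_inj.
Qed.

Lemma ev_swap12 u v f : ev u v (swap12 f) = ev v u f.
Proof. by rewrite swap12E [LHS]mmap_comp2 !mmapX !mmap1U. Qed.

Section Three.
Variables (u v w : V).
Let g : 'I_3 -> V := tnth [tuple u; v; w].
Let gX (i : 'I_3) : mmap h g 'X_i = g i.
Proof. by rewrite mmapX mmap1U. Qed.

Lemma ev_tens1r f : mmap h g (tens1r f) = ev u v f.
Proof. by rewrite mmap_comp2 !gX. Qed.

Lemma ev_tens1l f : mmap h g (tens1l f) = ev v w f.
Proof. by rewrite mmap_comp2 !gX. Qed.

Lemma ev_coprod_id f : mmap h g (coprod_id f) = ev (u + v) w f.
Proof. by rewrite mmap_comp2 rmorphD /= !gX. Qed.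

Lemma ev_id_coprod f : mmap h g (id_coprod f) = ev u (v + w) f.
Proof. by rewrite mmap_comp2 rmorphD /= !gX. Qed.

End Three.

Lemma ev_swap12_3 u v w (p : {mpoly k[3]}) :
  mmap h (tnth [tuple u; v; w]) (swap12 p) = mmap h (tnth [tuple v; u; w]) p.
Proof.
have -> : swap12 p = p \mPo [tuple 'X_1; 'X_0; 'X_(2 : 'I_3)].
  rewrite /swap12 /msym /comp_mpoly; apply: eq_bigr => M _; congr (_ * _).
  apply: mmap1_eq => -[[|[|[|//]]] lt_i] /=; rewrite !(tnth_nth 0) /=.
  - by rewrite (_ : Ordinal _ = 0) ?tpermL //; apply/val_inj.
  - by rewrite (_ : Ordinal _ = 1) ?tpermR //; apply/val_inj.
  - by rewrite (_ : Ordinal _ = 2) ?tpermD //; apply/val_inj.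
rewrite mmap_comp; apply: eq_bigr => M _; congr (_ * _).
apply: mmap1_eq => -[[|[|[|//]]] lt_i] /=; rewrite !(tnth_nth 0) /= mmapX mmap1U.
all: by rewrite !(tnth_nth 0).
Qed.

Lemma ev_extl u v w f f' :
  mmap h (tnth [tuple u; v; w]) (tens1r f * coprod_id f') =
  ev u v f * ev (u + v) w f'.
Proof. by rewrite rmorphM; congr (_ * _); [exact: ev_tens1r | exact: ev_coprod_id]. Qed.

Lemma ev_extr u v w f f' :
  mmap h (tnth [tuple u; v; w]) (tens1l f * id_coprod f') =
  ev v w f * ev u (v + w) f'.
Proof. by rewrite rmorphM; congr (_ * _); [exact: ev_tens1l | exact: ev_id_coprod]. Qed.

End Evaluation.

Section UniversalJacobi.
Variables (k : fieldType) (F : nat -> nat -> {mpoly k[2]}).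

Definition ev_jacobi (V : comNzRingType) (h : {rmorphism k -> V}) i j l u v w : Prop :=
  ev h u v (F i j) * ev h (u + v) w (F (tgt i j) l) =
  ev h v w (F j l) * ev h u (v + w) (F i (tgt j l)) -
  ev h u w (F i l) * ev h v (u + w) (F j (tgt i l)).

Lemma ev_jacobi_of i j l : jacobi_at F i j l ->
  forall (V : comNzRingType) (h : {rmorphism k -> V}) u v w, ev_jacobi h i j l u v w.
Proof.
move=> J V h u v w; rewrite /ev_jacobi.
move/(congr1 (mmap h (tnth [tuple u; v; w]))): J.
by rewrite mmapB ev_swap12_3 ev_extl !ev_extr.
Qed.

(** Evaluation at the three variables of {mpoly k[3]} is the identity map, so this one point carries
    the whole identity. *)
Lemma jacobi_of_ev i j l : 
  (forall u v w : {mpoly k[3]}, ev_jacobi (@mpolyC 3 k) i j l u v w) ->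
  jacobi_at F i j l.
Proof.
move/(_ 'X_0 'X_1 'X_(2%R : 'I_3)); rewrite /ev_jacobi /jacobi_at => J.
have id3 (p : {mpoly k[3]}) :
    mmap (@mpolyC 3 k) (tnth [tuple 'X_0; 'X_1; 'X_(2%R : 'I_3)]) p = p.
  rewrite [RHS]mpolyE /mmap; apply: eq_bigr => M _; rewrite mul_mpolyC.
  congr (_ *: _); rewrite -[RHS]mmap1_id; apply: mmap1_eq.
  by move=> -[[|[|[|//]]] lt_i]; rewrite (tnth_nth 0); congr (mpolyX _ U_(_)); apply/val_inj.
by rewrite -[LHS]id3 -[RHS]id3 mmapB ev_swap12_3 ev_extl !ev_extr.
Qed.

End UniversalJacobi.

Section JacobiSymmetry.
Variables (k : fieldType) (F : nat -> nat -> {mpoly k[2]}).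
Variables (V : comNzRingType) (h : {rmorphism k -> V}).
Hypothesis F_skew : forall i j, (i < 3)%N -> (j < 3)%N ->
  forall u v, ev h u v (F i j) = - ev h v u (F j i).
Let J i j l := forall u v w, ev_jacobi F h i j l u v w.

(** Under skew-symmetry, exchanging two indices together with their variables only changes signs and
    moves terms. The two adjacent transpositions generate all permutations, hence sorted triples
    suffice. *)
Lemma ev_jacobi_perm12 i j l : (i < 3)%N -> (j < 3)%N -> J i j l -> J j i l.
Proof.
move=> lt_i lt_j Jijl u v w; have := Jijl v u w; rewrite /ev_jacobi.
by rewrite (F_skew lt_j lt_i) (tgtC j i) (addrC u v) mulNr => ->; rewrite opprB.
Qed.

Lemma ev_jacobi_perm23 i j l : (i < 3)%N -> (j < 3)%N -> (l < 3)%N ->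
  J i j l -> J i l j.
Proof.
move=> lt_i lt_j lt_l Jijl u v w; have := Jijl u w v; rewrite /ev_jacobi.
rewrite (F_skew (tgt_lt i l) lt_j) (F_skew lt_l lt_j) (F_skew lt_l (tgt_lt i j)).
by rewrite (tgtC l j) (addrC w v) mulNr !mulrN opprK => ->; rewrite addKr.
Qed.

Lemma ev_jacobi_sorted :
  (forall i j l, (i <= j)%N -> (j <= l)%N -> (l < 3)%N -> J i j l) ->
  forall i j l, (i < 3)%N -> (j < 3)%N -> (l < 3)%N -> J i j l.
Proof.
move=> sJ i j l lt_i lt_j lt_l.
have p12 := ev_jacobi_perm12; have p23 := ev_jacobi_perm23.
have [ij|/ltnW ji] := leqP i j; have [jl|/ltnW lj] := leqP j l.
- exact: sJ.
- apply: (p23) => //; have [il|/ltnW li] := leqP i l; first exact: sJ.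
  by apply: (p12) => //; apply: sJ.
- apply: (p12) => //; have [il|/ltnW li] := leqP i l; first exact: sJ.
  by apply: (p23) => //; apply: sJ.
- by apply: (p12) => //; apply: (p23) => //; apply: (p12) => //; apply: sJ.
Qed.

End JacobiSymmetry.

(** * The four identities equivalent to the Schrödinger-Virasoro axioms *)

Section SchrodingerVirasoro.
Variables (k : fieldType) (L : lmodType {poly k}) (e0 e1 e2 : L).
Hypothesis basis_e : is_basis3 e0 e1 e2.

Lemma tensX1 : 'X \ox 1 = 'X_0 :> {mpoly k[2]}.
Proof. by rewrite /tens slot1 mulr1 /slot map_polyX hornerX. Qed.

Lemma tens1X : 1 \ox 'X = 'X_1 :> {mpoly k[2]}.
Proof. by rewrite /tens slot1 mul1r /slot map_polyX hornerX. Qed.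

Lemma swap12_tens (h1 h2 : {poly k}) : swap12 (h1 \ox h2) = h2 \ox h1.
Proof. by rewrite /tens swap12M !swap12_slot tpermL tpermR mulrC. Qed.

Lemma swap12B n (f g : {mpoly k[n.+2]}) : swap12 (f - g) = swap12 f - swap12 g.
Proof. exact: raddfB. Qed.

Lemma swap12Z n c (f : {mpoly k[n.+2]}) : swap12 (c *: f) = c *: swap12 f.
Proof. exact: linearZ. Qed.

Lemma swap12_sum n I (r : seq I) P (f : I -> {mpoly k[n.+2]}) :
  swap12 (\sum_(i <- r | P i) f i) = \sum_(i <- r | P i) swap12 (f i).
Proof. exact: raddf_sum. Qed.

Lemma sv_alpha'_skew m (f : {mpoly k[2]}) : is_sv_alpha' m f -> swap12 f = - f.
Proof.
case: m => [->|m [w [_ ->]]]; first by rewrite /swap12 rmorph0 oppr0.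
rewrite swap12_sum -sumrN; apply: eq_bigr => j _.
rewrite swap12_sum -sumrN; apply: eq_bigr => i _.
by rewrite swap12Z swap12B !swap12_tens -scalerN opprB.
Qed.

Variables (lam1 kap1 lam2 kap2 : k) (alpha' eta : {mpoly k[2]}).

(** Entries below the diagonal are those forced by skew-symmetry; the default 0 includes
    [e_2, e_2]. *)
Definition sv_const (i j : nat) : {mpoly k[2]} :=
  match i, j with
  | 0, 0 => sv_alpha k
  | 0, 1 => sv_beta lam1 kap1
  | 0, 2 => sv_beta lam2 kap2
  | 1, 0 => - swap12 (sv_beta lam1 kap1)
  | 2, 0 => - swap12 (sv_beta lam2 kap2)
  | 1, 1 => alpha'
  | 1, 2 => eta
  | 2, 1 => - swap12 eta
  | _, _ => 0
  end.

Lemma ev_alpha (V : comNzRingType) (h : {rmorphism k -> V}) u v :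
  ev h u v (sv_alpha k) = u - v.
Proof. by rewrite evB tensX1 tens1X evX0 evX1. Qed.

Lemma ev_beta (V : comNzRingType) (h : {rmorphism k -> V}) u v lam kap :
  ev h u v (sv_beta lam kap) = h lam * u - v + h kap.
Proof.
by rewrite evD evB !evZ tensX1 tens1X tens11 evX0 evX1 ev1 mulr1.
Qed.

(** The Jacobi identity at (0,1,1), (0,1,2), (1,1,1), (1,1,2), in this order. The sign in the third
    line comes from [e_2, e_1], the 0 in the fourth from [e_2, e_2]. *)
Definition sv_identities (V : comNzRingType) (h : {rmorphism k -> V}) u v w : Prop :=
  [/\ (h lam1 * u - v + h kap1) * ev h (u + v) w alpha' =
        ev h v w alpha' * (h lam2 * u - (v + w) + h kap2) -
          (h lam1 * u - w + h kap1) * ev h v (u + w) alpha',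
      (h lam1 * u - v + h kap1) * ev h (u + v) w eta =
        ev h v w eta * (h lam2 * u - (v + w) + h kap2) -
          (h lam2 * u - w + h kap2) * ev h v (u + w) eta,
      ev h u v alpha' * - ev h w (u + v) eta =
        ev h v w alpha' * ev h u (v + w) eta - ev h u w alpha' * ev h v (u + w) eta
    & 0 = ev h v w eta * ev h u (v + w) eta - ev h u w eta * ev h v (u + w) eta].

Lemma sv_const_skew : swap12 alpha' = - alpha' ->
  forall i j, (i < 3)%N -> (j < 3)%N -> sv_const i j = - swap12 (sv_const j i).
Proof.
move=> a_skew; have swapK (f : {mpoly k[2]}) : - swap12 (- swap12 f) = f.
  rewrite -[- swap12 f]sub0r swap12B opprB.
  have -> : swap12 (0 : {mpoly k[2]}) = 0 by rewrite /swap12 rmorph0.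
  by rewrite subr0 /swap12 -msymMm tperm2 msym1m.
case=> [|[|[|//]]] [|[|[|//]]] _ _ //=; rewrite ?swapK ?a_skew ?opprK //.
- by rewrite /sv_alpha swap12B !swap12_tens opprB.
- by rewrite /swap12 raddf0 oppr0.
Qed.

Lemma sv_identities_of_algebra m :
  (exists br, is_sv_algebra m e0 e1 e2 lam1 kap1 lam2 kap2 alpha' eta br) ->
  forall (V : comNzRingType) (h : {rmorphism k -> V}) u v w, sv_identities h u v w.
Proof.
case=> br [lie a_sv [b00 [b01 b02] b11 b12 b22]] V h u v w.
have [psb _ S] := lie.
have hNswap n f (a : L) : - hmap (@swap12 k n) (f \oxH a) = (- swap12 f) \oxH a.
  by rewrite hmap_pure ?hpureNl //; apply: coprod_linear_swap12.
have brF : has_constants e0 e1 e2 sv_const br.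
  case=> [|[|[|//]]] [|[|[|//]]] _ _ //=; rewrite /bas /= /tgt ?minnE //=.
  - by rewrite S b01 hNswap.
  - by rewrite S b02 hNswap.
  - by rewrite S b12 hNswap.
  - by rewrite b22 hpure0l.
have J i j l lt_i lt_j lt_l :=
  ev_jacobi_of (jacobi_of_lie basis_e psb brF lie (i:=i) (j:=j) (l:=l) lt_i lt_j lt_l) h u v w.
split.
- by have := J 0%N 1%N 1%N isT isT isT; rewrite /ev_jacobi /= !ev_beta.
- by have := J 0%N 1%N 2%N isT isT isT; rewrite /ev_jacobi /= !ev_beta.
- by have := J 1%N 1%N 1%N isT isT isT; rewrite /ev_jacobi /= evN ev_swap12.
- by have := J 1%N 1%N 2%N isT isT isT; rewrite /ev_jacobi /= ev0 mulr0.
Qed.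

Lemma sv_jacobi (V : comNzRingType) (h : {rmorphism k -> V}) i j l u v w :
  sv_identities h u v w -> (i <= j)%N -> (j <= l)%N -> (l < 3)%N ->
  ev_jacobi sv_const h i j l u v w.
Proof.
case=> H011 H012 H111 H112.
have E0 u' v' : ev h u' v' 0 = 0 by exact: ev0.
have E1 := ev_alpha h; have E2 u' v' := ev_beta h u' v'.
have E3 u' v' f : ev h u' v' (- swap12 f) = - ev h v' u' f.
  by rewrite evN ev_swap12.
case: l => [|[|[|//]]]; case: j => [|[|[|//]]]; case: i => [|[|[|//]]] // _ _ _.
(* Triples with 2 at least twice vanish because [e_2, e_2] = 0. What survives is (0,0,0), (0,0,1),
   (0,0,2), where the explicit alpha and beta satisfy the identity for all parameters. *)
all: rewrite /ev_jacobi ?E3 ?E2 ?E1 ?E0 ?mulr0 ?mul0r ?subrr //.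
- ring.
- ring.
- ring.
Qed.

Lemma sv_algebra_of_identities m : is_sv_alpha' m alpha' ->
  (forall u v w, sv_identities (@mpolyC 3 k) u v w) ->
  exists br, is_sv_algebra m e0 e1 e2 lam1 kap1 lam2 kap2 alpha' eta br.
Proof.
move=> a_sv H; have skew := sv_const_skew (sv_alpha'_skew a_sv).
have [br psb brF] := bracket_exists basis_e sv_const.
exists br; split=> //; last first.
  have B i j lt_i lt_j := brF i j lt_i lt_j.
  split; first exact: (B 0%N 0%N isT isT).
  - by split; [exact: (B 0%N 1%N isT isT) | exact: (B 0%N 2%N isT isT)].
  - exact: (B 1%N 1%N isT isT).
  - exact: (B 1%N 2%N isT isT).
  - by rewrite [LHS](B 2%N 2%N isT isT) hpure0l.
apply: (lie_of_constants basis_e psb brF) => // i j l lt_i lt_j lt_l.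
apply: jacobi_of_ev; apply: (ev_jacobi_sorted _ _ lt_i lt_j lt_l) => [a b lt_a lt_b u v|].
  by rewrite (skew a b) // evN ev_swap12.
move=> {lt_i lt_j lt_l} {}i {}j {}l ij jl lt_l u v w.
exact: sv_jacobi.
Qed.

End SchrodingerVirasoro.

(** * The recursion for the coefficients of alpha' *)

Section Recursion.
Variables (k : fieldType) (char_k : [pchar k] =i pred0).
Variables (c : nat -> nat -> k) (lam lam2 : k).
Hypothesis c_skew : forall a b, c a b = - c b a.
Hypothesis c_rec : forall n i j,
  ('C(n + i, n)%:R * lam - 'C(n + i, n.+1)%:R) * c (n + i) j +
  ('C(n + j, n)%:R * lam - 'C(n + j, n.+1)%:R) * c i (n + j) =
  (n == 0%N)%:R * lam2 * c i j.

Lemma natr_eq0_char n : (n%:R == 0 :> k) = (n == 0%N).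
Proof. exact: (iffLR (pcharf0P k) char_k). Qed.

Lemma natr_inj_char m n : m%:R = n%:R :> k -> m = n.
Proof.
wlog le_mn : m n / (m <= n)%N => [W mn|/eqP].
  by case/orP: (leq_total m n) => /W-> //.
rewrite eq_sym -subr_eq0 -natrB // natr_eq0_char subn_eq0 => le_nm.
by apply/eqP; rewrite eqn_leq le_mn.
Qed.

Lemma c_homog a b : (2 * lam - lam2 - (a + b)%:R) * c a b = 0.
Proof.
have := c_rec 0 a b; rewrite eqxx mulr1n !add0n !bin0 !bin1 !mul1r => /eqP.
by rewrite -subr_eq0 => /eqP <-; rewrite natrD; ring.
Qed.

Lemma c_diag a : c a a = 0.
Proof.
apply/eqP; have /eqP := c_skew a a; rewrite -subr_eq0 opprK -mulr2n -mulr_natl.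
by rewrite mulf_eq0 natr_eq0_char.
Qed.

(** For [j = 0] the second factor collapses to [lam]. Hence, unless [lam] is 0, every coefficient is
    a multiple of the extreme one of the same degree. *)
Lemma c_top n a :
  ('C(n.+1 + a, n.+1)%:R * lam - 'C(n.+1 + a, n.+2)%:R) * c (n.+1 + a) 0 +
    lam * c a n.+1 = 0.
Proof.
have := c_rec n.+1 a 0; rewrite addn0 binn (bin_small (ltnSn _)) mul1r subr0 => ->.
by rewrite !mul0r.
Qed.

Section Homogeneous.
Variable d : nat.
Hypothesis c_d : forall a b, (a + b)%N != d -> c a b = 0.

Lemma lead0_lam_neq0 : c d 0 = 0 -> lam != 0 -> forall a b, c a b = 0.
Proof.
move=> cd0 nz_lam a b; have [ab|/c_d//] := eqVneq (a + b)%N d.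
case: b ab => [|b] ab; first by move: ab; rewrite addn0 => ->.
have := c_top b a; rewrite addnC ab cd0 mulr0 add0r => /eqP.
by rewrite mulf_eq0 (negPf nz_lam) => /eqP.
Qed.

Lemma lead0_lam0 : (3 < d)%N -> c d 0 = 0 -> lam = 0 -> forall a b, c a b = 0.
Proof.
move=> lt3d cd0 lam0.
have rec n a b : 'C(n.+1 + a, n.+2)%:R * c (n.+1 + a) b
    + 'C(n.+1 + b, n.+2)%:R * c a (n.+1 + b) = 0.
  have := c_rec n.+1 a b; rewrite lam0 !mulr0 !sub0r !mul0r !mulNr -opprD.
  by move/eqP; rewrite oppr_eq0 => /eqP.
have [e de] : exists e, d = e.+4 by exists (d - 4)%N; lia.
(* The three relations overdetermine the coefficients with first index 1, 2, 3; elimination leaves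
   c(1, d-1) times 3 C(d-1, 3) + C(d-1, 2) C(d-2, 2). This integer is positive here but 0 for d = 3,
   where a solution survives. *)
have c1 : c 1 e.+3 = 0.
  have r1 := rec 0%N 1%N e.+2; have r2 := rec 0%N 2%N e.+1; have r3 := rec 1%N 1%N e.+1.
  rewrite !(add1n, add2n) in r1 r2 r3.
  rewrite !binn !mul1r in r1 r3; rewrite [in 'C(3, 2)]binSn in r2.
  have : (3 * 'C(e.+3, 3) + 'C(e.+3, 2) * 'C(e.+2, 2))%:R * c 1 e.+3 = 0.
    rewrite natrD !natrM; move/eqP: r1; rewrite addr_eq0 => /eqP r1.
    move/eqP: r3; rewrite addr_eq0 => /eqP r3; move: r2; rewrite r1 r3 => r2.
    by rewrite -[RHS]oppr0 -r2; ring.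
  move/eqP; rewrite mulf_eq0 natr_eq0_char => /orP[|/eqP//].
  by rewrite addn_eq0 !muln_eq0 /= -!leqn0 leqNgt bin_gt0.
(* The relation for [n = 0] passes from first index a + 1 to a + 2, with the nonzero factor C(a+2,
   2). *)
have ca a b : (a.+1 + b)%N = d -> c a.+1 b = 0.
  elim: a b => [|a IH] b ab; first by rewrite -c1; congr (c _ _); lia.
  have := rec 0%N a.+1 b; rewrite !add1n [c a.+1 _]IH; last by lia.
  rewrite mulr0 addr0 => /eqP; rewrite mulf_eq0 natr_eq0_char => /orP[|/eqP//].
  by rewrite -leqn0 leqNgt bin_gt0.
move=> a b; have [ab|/c_d//] := eqVneq (a + b)%N d.
case: a ab => [|a]; last exact: ca.
by rewrite add0n => ->; rewrite c_skew cd0 oppr0.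
Qed.

(* If [c d 0 != 0], the equations for [n = 1, d - 1] give [4 d lam = d^2 - d + 2]
   and those for [n = 2, d - 2] give [6 (d - 1) lam = d^2 - 3 d + 8]; eliminating
   [lam] leaves [(d - 3) (d + 1) (d + 2) = 0]. *)
Lemma lead_neq0_deg : (3 < d)%N -> c d 0 = 0.
Proof.
move=> lt3d; apply/eqP; apply: contraT => nz_p.
have [e de] : exists e, d = e.+4 by exists (d - 4)%N; lia.
(* In the pairs [t1], [t3] and [t2], [t4] the other coefficients are transposes of each other;
   adding cancels them by skew-symmetry and leaves a condition on [lam] alone. *)
have t1 := c_top 0 e.+3; have t2 := c_top 1 e.+2.
have t3 := c_top e.+2 1; have t4 := c_top e.+1 2.
rewrite !(add1n, add2n) in t1 t2; rewrite !(addn1, addn2) in t3 t4.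
rewrite -de in t1 t2 t3 t4.
have s1 : 'C(d, e.+3) = d by rewrite de binSn.
have s2 : 'C(d, e.+2) = 'C(d, 2) by rewrite de -(@bin_sub e.+4 2) //; congr (binomial _ _); lia.
have s3 : 'C(d, d) = 1%N by rewrite binn.
rewrite s1 s2 s3 in t3 t4 *; rewrite bin1 in t1.
have a1 : 2 * d%:R * lam = (1 + 'C(d, 2))%:R.
  apply: (mulIf nz_p); move: t1 t3; rewrite [c 1 _]c_skew => t1 t3.
  by apply/eqP; rewrite -subr_eq0 -[X in _ == X](addr0 0) -{2}t1 -t3 natrD; apply/eqP; ring.
have a2 : 2 * 'C(d, 2)%:R * lam = ('C(d, 3) + d)%:R.
  apply: (mulIf nz_p); move: t2 t4; rewrite [c 2 _]c_skew => t2 t4.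
  by apply/eqP; rewrite -subr_eq0 -[X in _ == X](addr0 0) -{2}t2 -t4 natrD; apply/eqP; ring.
have /natr_inj_char : (d * ('C(d, 3) + d))%:R = ('C(d, 2) * (1 + 'C(d, 2)))%:R :> k.
  by rewrite !natrM -a1 -a2; ring.
have b2 : ('C(d, 2) * 2)%N = (e.+4 * e.+3)%N 
  by rewrite de; apply: etrans (bin_ffact e.+4 2) _; rewrite !ffactnS ffactn0 muln1.
have b3 : ('C(d, 3) * 6)%N = (e.+4 * (e.+3 * e.+2))%N 
  by rewrite de; apply: etrans (bin_ffact e.+4 3) _; rewrite !ffactnS ffactn0 muln1.
move: b2 b3; rewrite de; move: 'C(_, 2) 'C(_, 3) => B2 B3 b2 b3 E.
(* Multiplying by 24 clears the denominators of both binomials; the excess in [E2] is then 2 d (d-3)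
   (d+1) (d+2), positive for d > 3. *)
have E1 : (4 * (e.+4 * (B3 * 6 + 6 * e.+4)) = 6 * (B2 * 2 * (2 + B2 * 2)))%N by nia.
rewrite b2 b3 in E1.
have E2 : (6 * (e.+4 * e.+3 * (2 + e.+4 * e.+3)) =
  4 * (e.+4 * (e.+4 * (e.+3 * e.+2) + 6 * e.+4)) + 2 * (e.+4 * e.+1 * e.+4.+1 * e.+4.+2))%N.
  ring.
by rewrite -E1 in E2; lia.
Qed.

End Homogeneous.

Lemma recursion_solutions : (exists a b, c a b != 0) -> exists d : nat,
  [/\ forall a b, (a + b)%N != d -> c a b = 0, lam2 = 2 * lam - d%:R
    & [\/ d = 1%N, d = 2%N /\ lam = 1 / 2,
          [/\ d = 3%N, lam = 2 / 3, c 3 0 != 0 & c 2 1 = 3 / 2 * c 3 0]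
        | [/\ d = 3%N, lam = 0 & c 3 0 = 0] ]].
Proof.
case=> a0 [b0 nz_c]; pose d := (a0 + b0)%N; exists d.
have lamE : lam2 = 2 * lam - d%:R.
  have /eqP := c_homog a0 b0; rewrite mulf_eq0 (negPf nz_c) orbF subr_eq0 => /eqP E.
  by rewrite /d -E; ring.
have c_d a b : (a + b)%N != d -> c a b = 0.
  move=> ne_d; have /eqP := c_homog a b; rewrite mulf_eq0 => /orP[|/eqP//].
  have -> : 2 * lam - lam2 - (a + b)%:R = d%:R - (a + b)%:R by rewrite lamE; ring.
  by rewrite subr_eq0 => /eqP/natr_inj_char E; rewrite -E eqxx in ne_d.
have not0 : ~ forall a b, c a b = 0 by move/(_ a0 b0)/eqP; rewrite (negPf nz_c).
have nz2 : 2 != 0 :> k by rewrite natr_eq0_char.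
have nz3 : 3 != 0 :> k by rewrite natr_eq0_char.
split=> //; have [lt3d|] := ltnP 3 d.
  case: not0; have cd0 := lead_neq0_deg lt3d.
  by have [|] := eqVneq lam 0; [apply: (lead0_lam0 c_d lt3d cd0) | apply: (lead0_lam_neq0 c_d)].
have cE a b e : d = e -> (a + b)%N != e -> c a b = 0 by move=> <-; apply: c_d.
case dE: d => [|[|[|[|//]]]] _.
(* Degree 0 is impossible: its only coefficient is diagonal. *)
- case: not0 => a b; have [->|] := eqVneq a 0%N.
    by case: b => [|b]; [exact: c_diag | exact: (cE _ _ _ dE)].
  by move=> nz_a; apply: (cE _ _ _ dE); rewrite addn_eq0 (negPf nz_a).
- by constructor 1.
- constructor 2; split=> //; have nz_p : c 2 0 != 0.
    apply/eqP => c20; apply: not0 => a b; have [ab|] := eqVneq (a + b)%N 2; last exact: cE.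
    case: a b ab => [|[|[|//]]] [|[|[|//]]] //= _; rewrite ?c_diag //.
    by rewrite c_skew c20 oppr0.
  have := c_top 0 1; rewrite addn1 c_diag mulr0 addr0 binn bin1 => /eqP.
  rewrite mulf_eq0 (negPf nz_p) orbF subr_eq0 => /eqP E.
  by apply: (mulfI nz2); rewrite [LHS]E; field.
(* The sum of these relations is (6 lam - 4) c(3,0) = 0; the second one afterwards fixes the ratio
   of c(2,1) to c(3,0). *)
have := c_top 0 2; have := c_top 1 1; rewrite !addn1 !addn2 [c 1 2]c_skew.
rewrite (_ : 'C(3, 1) = 3%N) // (_ : 'C(3, 2) = 3%N) // binn => E1 E2.
have [c30|nz_p] := eqVneq (c 3 0) 0.
- constructor 4; split=> //; apply/eqP; apply: contraT => nz_lam.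
  by case: not0; apply: (lead0_lam_neq0 c_d) => //; rewrite dE.
- have lam23 : lam = 2 / 3.
    apply: (mulfI nz3); apply: (mulfI nz2); apply: (mulIf nz_p).
    apply/eqP; rewrite -subr_eq0 -[X in _ == X](addr0 0) -{2}E1 -E2; apply/eqP.
    by field.
  constructor 3; split=> //; apply: (mulfI nz2); apply/eqP.
  rewrite -subr_eq0 -[X in _ == X](mulr0 3) -E2 lam23; apply/eqP; field.
  by rewrite nz2 nz3.
Qed.

End Recursion.

(** * Coefficient extraction *)

Section Coefficients.
Variable k : fieldType.

Definition mnm2 (a b : nat) : 'X_{1..2} := Multinom [tuple a; b].

Definition coef2 (f : {mpoly k[2]}) (a b : nat) : k := f@_(mnm2 a b).

Lemma ord2P (i : 'I_2) : i = 0 \/ i = 1.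
Proof. by case: i => -[|[|//]] lt_i; [left | right]; apply/val_inj. Qed.

Lemma mnm2_0 a b : mnm2 a b 0 = a. Proof. by rewrite multinomE. Qed.

Lemma mnm2_1 a b : mnm2 a b 1 = b. Proof. by rewrite multinomE. Qed.

Lemma mnm2_eq (M : 'X_{1..2}) a b : (M == mnm2 a b) = (M 0 == a) && (M 1 == b).
Proof.
apply/eqP/andP => [->|[/eqP M0 /eqP M1]]; first by rewrite mnm2_0 mnm2_1.
by apply/mnmP => i; case: (ord2P i) => ->; rewrite ?mnm2_0 ?mnm2_1.
Qed.

Lemma coef2_skew f : swap12 f = - f -> forall a b, coef2 f a b = - coef2 f b a.
Proof.
move=> f_skew a b; rewrite /coef2 -mcoeffN -f_skew mcoeff_sym; congr mcoeff.
by apply/esym/eqP; rewrite mnm2_eq !mnmE tpermL tpermR mnm2_0 mnm2_1 !eqxx.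
Qed.

Lemma coef2_mnm f (M : 'X_{1..2}) : coef2 f (M 0) (M 1) = f@_M.
Proof.
by rewrite /coef2; congr mcoeff; apply/esym/eqP; rewrite mnm2_eq !eqxx.
Qed.

Lemma coef2_inj f g : (forall a b, coef2 f a b = coef2 g a b) -> f = g.
Proof. by move=> fg; apply/mpolyP => M; rewrite -!coef2_mnm. Qed.

Lemma coef2_XX a b i j :
  coef2 ('X_0 ^+ a * 'X_1 ^+ b) i j = ((a == i) && (b == j))%:R.
Proof.
rewrite /coef2 !mpolyXn -mpolyXD mcoeffX; congr (_%:R); congr nat_of_bool.
by rewrite mnm2_eq !mnmDE !mulmnE !mnm1E /= !(mul0n, mul1n, add0n, addn0).
Qed.

Lemma ev_sum (R : comNzRingType) (h : {rmorphism k -> R}) (u v : R) f :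
  ev h u v f = \sum_(M <- msupp f) h f@_M * (u ^+ M 0 * v ^+ M 1).
Proof.
apply: eq_bigr => M _; congr (_ * _).
rewrite /mmap1 big_ord_recr big_ord1 /= !(tnth_nth 0) /=.
by congr (_ ^+ M _ * _ ^+ M _); apply/val_inj.
Qed.

Local Notation V := {poly {poly {poly k}}}.

(** The outermost variable is [x] and the innermost [z], so the iterated coefficient with indices n,
    i, j is that of x^n y^i z^j. *)
Definition hC : {rmorphism k -> V} := polyC \o (polyC \o polyC).
Local Notation x := ('X : V).
Local Notation y := ('X%:P : V).
Local Notation z := ('X%:P%:P : V).

(** For the substitutions used, a single monomial of [f] contributes to a given coefficient, with
    multiplicity [C]. *)
Lemma coef_ev (u v : V) f n i j a b (C : nat) :
  (forall c A B, (hC c * (u ^+ A * v ^+ B))`_n`_i`_j = c * ((A == a) && (B == b))%:R * C%:R) ->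
  (ev hC u v f)`_n`_i`_j = C%:R * coef2 f a b.
Proof.
move=> H; rewrite ev_sum !coef_sum mulrC /coef2 [in RHS](mpolyE f) raddf_sum mulr_suml.
apply: eq_bigr => M _; rewrite H /= mcoeffZ mcoeffX; congr (_ * _%:R * _).
by rewrite mnm2_eq.
Qed.

Lemma coef_XaddC_exp (R : comNzRingType) (c : R) a n :
  (('X + c%:P) ^+ a)`_n = c ^+ (a - n) *+ 'C(a, n).
Proof.
rewrite addrC exprDn coef_sum; have [le_na|lt_an] := leqP n a.
  rewrite (bigD1 (Ordinal (le_na : (n < a.+1)%N))) //= big1 => [|i ne_in].
    by rewrite addr0 coefMn -rmorphXn coefCM coefXn eqxx mulr1.
  rewrite coefMn -rmorphXn coefCM coefXn eq_sym.
  by rewrite -val_eqE /= in ne_in; rewrite (negPf ne_in) mulr0 mul0rn.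
rewrite bin_small // mulr0n big1 // => i _.
rewrite coefMn -rmorphXn coefCM coefXn gtn_eqF ?mulr0 ?mul0rn //.
exact: leq_trans (ltn_ord i) lt_an.
Qed.

Lemma coef_monomial (c : k) A B C i j :
  ((c%:P * 'X^B)%:P * ('X^A *+ C) : {poly {poly k}})`_i`_j =
  c * ((A == i) && (B == j))%:R * C%:R.
Proof.
rewrite mulrnAr !coefMn coefCM coefXn [i == A]eq_sym [RHS]mulr_natr; congr (_ *+ _).
by case: (A == i); rewrite ?mulr0 ?coef0 // mulr1 coefCM coefXn eq_sym.
Qed.

(** The truncated difference could match wrongly when A < n, but there the binomial is 0. *)
Lemma bin_shift A n i : ((A - n == i) * 'C(A, n) = (A == n + i) * 'C(n + i, n))%N.
Proof.
have [->|ne] := eqVneq A (n + i)%N; first by rewrite addKn eqxx.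
have [le_nA|lt_An] := leqP n A; last by rewrite bin_small // muln0.
by case: eqP => // E; case/eqP: ne; rewrite -E subnKC.
Qed.

Lemma coef_ev_xy f n i j :
  (ev hC (x + y) z f)`_n`_i`_j = 'C(n + i, n)%:R * coef2 f (n + i) j.
Proof.
apply: coef_ev => c A B.
have -> : hC c * ((x + y) ^+ A * z ^+ B) = (c%:P * 'X^B)%:P%:P * (x + y) ^+ A.
  by rewrite !rmorphM !rmorphXn /= mulrCA mulrC.
rewrite coefCM coef_XaddC_exp coef_monomial -!mulrA -!natrM.
congr (_ * _%:R); have := bin_shift A n i; case: (B == j); rewrite ?andbF // !andbT.
by rewrite mulnC.
Qed.

Lemma coef_ev_yx f n i j :
  (ev hC y (x + z) f)`_n`_i`_j = 'C(n + j, n)%:R * coef2 f i (n + j).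
Proof.
apply: coef_ev => c A B.
have -> : hC c * (y ^+ A * (x + z) ^+ B) = (c%:P%:P * 'X^A)%:P * (x + z) ^+ B.
  by rewrite !rmorphM !rmorphXn /= mulrA.
rewrite coefCM coef_XaddC_exp.
have -> : c%:P%:P * 'X^A * ('X%:P ^+ (B - n) *+ 'C(B, n)) =
    (c%:P * 'X^(B - n))%:P * 'X^A *+ 'C(B, n) :> {poly {poly k}}.
  by rewrite mulrnAr rmorphM rmorphXn /= mulrAC.
rewrite -mulrnAr coef_monomial -!mulrA -!natrM.
congr (_ * _%:R); have := bin_shift B n j; case: (A == i) => //.
Qed.

Lemma coef_ev_yz f n i j :
  (ev hC y z f)`_n`_i`_j = (n == 0%N)%:R * coef2 f i j.
Proof.
apply: coef_ev => c A B.
have -> : hC c * (y ^+ A * z ^+ B) = ((c%:P * 'X^B)%:P * ('X^A *+ 1))%:P.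
  by rewrite !rmorphM !rmorphXn /= mulrAC mulrA.
rewrite coefC; case: (n == 0%N); last by rewrite !coef0 mulr0.
by rewrite coef_monomial.
Qed.

End Coefficients.

(** * Solving the identities *)

Section Identities.
Variables (k : fieldType) (char_k : [pchar k] =i pred0).
Variables (lam1 kap1 lam2 kap2 : k) (alpha' eta : {mpoly k[2]}).
Hypothesis ids : forall (V : comNzRingType) (h : {rmorphism k -> V}) u v w,
  sv_identities lam1 kap1 lam2 kap2 alpha' eta h u v w.

Local Notation V := {poly {poly {poly k}}}.
Local Notation x := ('X : V).
Local Notation y := ('X%:P : V).
Local Notation z := ('X%:P%:P : V).
Local Notation hM := (@mpolyC 2 k).

Lemma ev_id (f : {mpoly k[2]}) : ev hM 'X_0 'X_1 f = f.
Proof.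
rewrite [RHS]mpolyE; apply: eq_bigr => M _; rewrite mul_mpolyC.
congr (_ *: _); rewrite -[RHS]mmap1_id; apply: mmap1_eq => i.
by rewrite (tnth_nth 0); case: (ord2P i) => ->.
Qed.

Lemma kap2E : alpha' != 0 -> kap2 = 2 * kap1.
Proof.
move=> nz_a; have [H _ _ _] := ids hM 0 'X_0 'X_1.
rewrite !mulr0 !add0r ev_id in H.
have gen (R : comNzRingType) (a X0 X1 p q : R) :
    (- X0 + p) * a = a * (- (X0 + X1) + q) - (- X1 + p) * a -> (q - 2 * p) * a = 0.
  by move/eqP; rewrite -subr_eq0 => /eqP E; rewrite -[RHS]oppr0 -E; ring.
have : (kap2 - 2 * kap1) *: alpha' = 0.
  by rewrite -mul_mpolyC mpolyCB mpolyCM mpolyC_nat; apply: gen H.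
by move/eqP; rewrite scaler_eq0 (negPf nz_a) orbF subr_eq0 => /eqP.
Qed.

Lemma kap1_eta : kap1 *: eta = 0.
Proof.
have [_ H _ _] := ids hM 0 'X_0 'X_1.
rewrite !mulr0 !add0r ev_id in H.
have gen (R : comNzRingType) (a X0 X1 p q : R) :
    (- X0 + p) * a = a * (- (X0 + X1) + q) - (- X1 + q) * a -> p * a = 0.
  by move/eqP; rewrite -subr_eq0 => /eqP E; rewrite -E; ring.
by rewrite -mul_mpolyC; apply: gen H.
Qed.

(* Compare degrees in [x] in [eta(y,z) eta(x,y+z) = eta(x,z) eta(y,x+z)]: both
   [eta(x,y+z)] and [eta(x,z)] have the same one, so [eta(y,x+z)] has degree 0. *)
Lemma eta_first : eta != 0 -> forall a b, coef2 eta a b.+1 = 0.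
Proof.
move=> nz_eta.
have nz (u v : V) a b i j n : (ev (hC k) u v eta)`_n`_i`_j = coef2 eta a b ->
    coef2 eta a b != 0 -> ev (hC k) u v eta != 0.
  by move=> E; apply: contraNneq => E0; rewrite -E E0 !coef0.
have [a0 [b0 nz_ab]] : exists a b, coef2 eta a b != 0.
  apply: contrapT => no; case/eqP: nz_eta; apply: coef2_inj => a b.
  have -> : coef2 0 a b = 0 :> k by rewrite /coef2 mcoeff0.
  by apply/eqP; apply: contraT => nz_ab; case: no; exists a, b.
have xzE n i j : (ev (hC k) x z eta)`_n`_i`_j = (i == 0%N)%:R * coef2 eta n j.
  apply: coef_ev => c A B.
  have -> : hC k c * (x ^+ A * z ^+ B) = (c%:P * 'X^B)%:P%:P * 'X^A.
    by rewrite !rmorphM !rmorphXn /= mulrCA mulrC.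
  rewrite coefCM coefXn [n == A]eq_sym; case: (A == n); last by rewrite mulr0 !coef0 mulr0 mul0r.
  rewrite mulr1 coefC; case: (i == 0%N); last by rewrite coef0 mulr0.
  by rewrite coefCM coefXn eq_sym !mulr1.
pose D := ev (hC k) y z eta; pose A := ev (hC k) x (y + z) eta.
pose B := ev (hC k) x z eta; pose C := ev (hC k) y (x + z) eta.
have DA_BC : D * A = B * C.
  by have [_ _ _ /esym/eqP] := ids (hC k) x y z; rewrite subr_eq0 => /eqP.
have nzB : B != 0.
  by apply: (nz _ _ a0 b0 0%N b0 a0) => //; rewrite xzE mul1r.
have nzD : D != 0.
  by apply: (nz _ _ a0 b0 a0 b0 0%N) => //; rewrite coef_ev_yz mul1r.
have nzC : C != 0.
  by apply: (nz _ _ a0 b0 a0 b0 0%N) => //; rewrite coef_ev_yx bin0 mul1r.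
have D_const : D = (D`_0)%:P.
  apply/polyP => -[|n]; rewrite coefC //=.
  by apply/polyP => i; apply/polyP => j; rewrite coef_ev_yz mul0r !coef0.
(* The coefficient of x^n in [A] involves only monomials of eta with first exponent n, and these are
   all visible in the coefficient of x^n in [B]. *)
have A_size : (size A <= size B)%N.
  apply/leq_sizeP => n le_Bn; rewrite /A ev_sum coef_sum big1 // => M _.
  have [Mn|ne] := eqVneq (M 0) n; last first.
    have -> : hC k eta@_M * (x ^+ M 0 * (y + z) ^+ M 1) =
        ((eta@_M)%:P%:P * ('X + 'X%:P) ^+ M 1)%:P * 'X^(M 0).
      by rewrite rmorphM rmorphXn rmorphD /= mulrCA mulrC.
    by rewrite coefCM coefXn eq_sym (negPf ne) mulr0.
  have -> : eta@_M = 0.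
    have := xzE n 0%N (M 1); rewrite -/B (nth_default 0 le_Bn) !coef0 mul1r -Mn.
    by rewrite coef2_mnm.
  by rewrite rmorph0 mul0r coef0.
have C_size : (size C <= 1)%N.
  have := congr1 (fun p : V => size p) DA_BC.
  rewrite /= D_const size_Cmul; last by apply: contraNneq nzD => E; rewrite D_const E.
  rewrite size_mul // => E; rewrite E in A_size.
  have gt0B : (0 < size (B : V))%N by rewrite size_poly_gt0.
  have num p q : ((p + q).-1 <= p)%N -> (0 < p)%N -> (q <= 1)%N by lia.
  exact: num A_size gt0B.
move=> a b; have := coef_ev_yx eta b.+1 a 0; rewrite -/C.
rewrite (nth_default 0 (leq_trans C_size (ltn0Sn b))) !coef0 addn0 binn mul1r.
by move/esym.
Qed.

Lemma eta_ev (R : comNzRingType) (h : {rmorphism k -> R}) u v v' : eta != 0 ->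
  ev h u v eta = ev h u v' eta.
Proof.
move/eta_first=> eta0; rewrite !ev_sum; apply: eq_bigr => M _; rewrite -coef2_mnm.
by case: (M 1) => [|b]; rewrite ?expr0 // eta0 rmorph0 !mul0r.
Qed.

(** Since eta does not depend on its second argument, setting the middle variable to 0 cancels the
    right-hand side and leaves lambda_1 x eta = 0. *)
Lemma lam1_eta : lam1 *: eta = 0.
Proof.
have [->|nz_eta] := eqVneq eta 0; first by rewrite scaler0.
have [_ H _ _] := ids hM 'X_0 0 'X_1.
have kap1_0 : kap1 = 0.
  by have /eqP := kap1_eta; rewrite scaler_eq0 (negPf nz_eta) orbF => /eqP.
rewrite (eta_ev hM 0 ('X_0 + 'X_1) 'X_1 nz_eta) !addr0 ev_id kap1_0 rmorph0 in H.
have gen (R : comNzRingType) (l1 l2 k2 X0 X1 e g : R) :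
    (l1 * X0 - 0 + 0) * e = g * (l2 * X0 - (0 + X1) + k2) - (l2 * X0 - X1 + k2) * g ->
    l1 * (X0 * e) = 0.
  by move/eqP; rewrite -subr_eq0 => /eqP E; rewrite -E; ring.
have {}H := gen _ _ _ _ _ _ _ _ H.
move: H; rewrite mul_mpolyC => /eqP; rewrite scaler_eq0 mulf_eq0 (negPf nz_eta) orbF.
have nzX : 'X_0 != 0 :> {mpoly k[2]}.
  apply/eqP => /(congr1 (mcoeff U_(0))); rewrite mcoeffXU eqxx mcoeff0.
  by move/eqP; rewrite oner_eq0.
by rewrite (negPf nzX) orbF => /eqP->; rewrite scale0r.
Qed.

Lemma eta_const : exists a, [/\ eta = a *: 1, a * lam1 = 0 & a * kap1 = 0].
Proof.
have [->|nz_eta] := eqVneq eta 0; first by exists 0; rewrite scale0r !mul0r.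
have /eqP := lam1_eta; rewrite scaler_eq0 (negPf nz_eta) orbF => /eqP lam1_0.
have /eqP := kap1_eta; rewrite scaler_eq0 (negPf nz_eta) orbF => /eqP kap1_0.
exists (coef2 eta 0 0); rewrite lam1_0 kap1_0 !mulr0; split=> //.
apply: coef2_inj => i j.
have -> : coef2 (coef2 eta 0 0 *: 1) i j = coef2 eta 0 0 * ((0 == i) && (0 == j))%N%:R.
  by rewrite -coef2_XX !expr0 mulr1 /coef2 mcoeffZ.
case: j => [|j]; last by rewrite eta_first // andbF mulr0.
case: i => [|n]; first by rewrite mulr1.
rewrite mulr0; have [_ H _ _] := ids (hC k) x y z.
rewrite (eta_ev (hC k) y (x + z) z nz_eta) lam1_0 kap1_0 !rmorph0 in H.
(* The identity now reads y (eta(x+y) - eta(y)) = 0: eta is invariant under translation. The terms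
   x^(n+1) y^0 then kill every nonconstant coefficient. *)
have gen (R : comNzRingType) (l2 k2 X0 X1 X2 e g : R) :
    (0 * X0 - X1 + 0) * e = g * (l2 * X0 - (X1 + X2) + k2) - (l2 * X0 - X2 + k2) * g ->
    X1 * (e - g) = 0.
  by move/eqP; rewrite -subr_eq0 => /eqP E; rewrite -[RHS]oppr0 -E; ring.
have {H} /eqP := gen _ _ _ _ _ _ _ _ H.
rewrite mulf_eq0 polyC_eq0 polyX_eq0 /= subr_eq0 => /eqP.
move/(congr1 (fun p : V => p`_n.+1`_0`_0)); rewrite coef_ev_xy coef_ev_yz mul0r.
by rewrite addn0 binn mul1r.
Qed.

(** This is the (1,1,1) identity with last variable 0, chosen because the unshifted form y^2 z - y
    z^2 vanishes when z = 0, leaving a alpha' = 0. *)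
Lemma eta_alpha' a : eta = a *: 1 ->
  a *: (alpha' + ev hM 'X_1 0 alpha' - ev hM 'X_0 0 alpha') = 0.
Proof.
move=> etaE; have [_ _ H _] := ids hM 'X_0 'X_1 0.
have evE u v : ev hM u v eta = a%:MP by rewrite etaE evZ ev1 mulr1.
rewrite !evE ev_id in H; rewrite -mul_mpolyC.
have gen (R : comNzRingType) (A B C e : R) : A * - e = B * e - C * e ->
    e * (A + B - C) = 0.
  by move/eqP; rewrite -subr_eq0 => /eqP E; rewrite -[RHS]oppr0 -E; ring.
exact: gen H.
Qed.

(** * The shift by kappa_1 and the possible shapes of alpha' *)

Section Shift.
Hypotheses (nz_a : alpha' != 0) (a_skew : swap12 alpha' = - alpha').

(** With t = kappa_1, the constants in lambda_1 x - y + kappa_1 and lambda_2 x - (y + z) + 2 kappa_1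
    are both absorbed. *)
Definition shifted (f : {mpoly k[2]}) (t : k) := ev hM ('X_0 + t%:MP) ('X_1 + t%:MP) f.
Let P := shifted alpha' kap1.

Lemma ev_shifted (R : comNzRingType) (h : {rmorphism k -> R}) u v f t :
  ev h u v (shifted f t) = ev h (u + h t) (v + h t) f.
Proof. by rewrite [LHS]mmap_comp2 !rmorphD /= !mmapC !mmapX !mmap1U. Qed.

Lemma shiftedK f t : shifted (shifted f t) (- t) = f.
Proof. by rewrite {1}/shifted ev_shifted !mpolyCN !subrK ev_id. Qed.

Let P_skew : swap12 P = - P.
Proof.
by rewrite swap12E [LHS]ev_shifted -[LHS]ev_swap12 a_skew evN.
Qed.

Let P_ids u v w : (hC k lam1 * u - v) * ev (hC k) (u + v) w P =
  ev (hC k) v w P * (hC k lam2 * u - (v + w)) - (hC k lam1 * u - w) * ev (hC k) v (u + w) P.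
Proof.
have [H _ _ _] := ids (hC k) u (v + hC k kap1) (w + hC k kap1).
rewrite kap2E // !addrA in H; rewrite !ev_shifted.
have gen (R : comNzRingType) (l1 l2 a b c t e f g : R) :
    (l1 * a - (b + t) + t) * e = f * (l2 * a - (b + t + c + t) + 2 * t) -
      (l1 * a - (c + t) + t) * g ->
    (l1 * a - b) * e = f * (l2 * a - (b + c)) - (l1 * a - c) * g.
  move/eqP; rewrite -subr_eq0 => /eqP E; apply/eqP; rewrite -subr_eq0 -E.
  by apply/eqP; ring.
rewrite rmorphM rmorph_nat in H.
exact: (gen _ _ _ _ _ _ _ _ _ _ H).
Qed.

(** Comparison at x^(n+1) y^i z^j. A factor [x] leaves x^n and gives the first binomial; a factor
    [y] or [z] lowers i or j instead and gives the second. *)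
Let coef_P_rec n i j :
  ('C(n + i, n)%:R * lam1 - 'C(n + i, n.+1)%:R) * coef2 P (n + i) j +
  ('C(n + j, n)%:R * lam1 - 'C(n + j, n.+1)%:R) * coef2 P i (n + j) =
  (n == 0%N)%:R * lam2 * coef2 P i j.
Proof.
have := congr1 (fun p : V => p`_n.+1`_i`_j) (P_ids x y z).
have hxE l (E : V) : (hC k l * x * E)`_n.+1`_i`_j = l * E`_n`_i`_j.
  by rewrite -mulrA /= !coefCM coefXM.
have yE (E : V) : (y * E)`_n.+1`_i`_j = if i is i'.+1 then E`_n.+1`_i'`_j else 0.
  by rewrite coefCM coefXM; case: (i) => [|i'] /=; rewrite ?coef0.
have zE (E : V) : (z * E)`_n.+1`_i`_j = if j is j'.+1 then E`_n.+1`_i`_j' else 0.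
  by rewrite !coefCM coefXM; case: (j).
set E1 := ev (hC k) (x + y) z P; set E2 := ev (hC k) y z P; set E3 := ev (hC k) y (x + z) P.
have -> : (hC k lam1 * x - y) * E1 = hC k lam1 * x * E1 - y * E1 by rewrite mulrBl.
have -> : E2 * (hC k lam2 * x - (y + z)) - (hC k lam1 * x - z) * E3 =
    hC k lam2 * x * E2 - y * E2 - z * E2 - (hC k lam1 * x * E3 - z * E3).
  by rewrite mulrC mulrBl mulrDl opprD addrA mulrBl.
rewrite !coefB !hxE !yE !zE /E1 /E2 /E3 => H.
(* For i = 0 the formula persists, as C(n, n+1) = 0. *)
have y1 : (if i is i'.+1 then (ev (hC k) (x + y) z P)`_n.+1`_i'`_j else 0) =
    'C(n + i, n.+1)%:R * coef2 P (n + i) j.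
  case: (i) => [|i']; first by rewrite addn0 bin_small // mul0r.
  by rewrite coef_ev_xy addSnnS.
have z3 : (if j is j'.+1 then (ev (hC k) y (x + z) P)`_n.+1`_i`_j' else 0) =
    'C(n + j, n.+1)%:R * coef2 P i (n + j).
  case: (j) => [|j']; first by rewrite addn0 bin_small // mul0r.
  by rewrite coef_ev_yx addSnnS.
have y2 : (if i is i'.+1 then (ev (hC k) y z P)`_n.+1`_i'`_j else 0) = 0.
  by case: (i) => // i'; rewrite coef_ev_yz mul0r.
have z2 : (if j is j'.+1 then (ev (hC k) y z P)`_n.+1`_i`_j' else 0) = 0.
  by case: (j) => // j'; rewrite coef_ev_yz mul0r.
rewrite y1 y2 z2 z3 coef_ev_xy coef_ev_yx coef_ev_yz in H.
move/eqP: H; rewrite -subr_eq0 => /eqP H; apply/eqP; rewrite -subr_eq0 -H.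
by apply/eqP; ring.
Qed.

Lemma alpha'_cases : exists (d : nat) (p : k),
  lam2 = 2 * lam1 - d%:R /\
  [\/ d = 1%N /\ alpha' = shifted (p *: ('X_0 - 'X_1)) (- kap1),
      [/\ d = 2%N, lam1 = 1 / 2
        & alpha' = shifted (p *: ('X_0 ^+ 2 - 'X_1 ^+ 2)) (- kap1)],
      [/\ d = 3%N, lam1 = 2 / 3
        & alpha' = shifted (p *: (('X_0 ^+ 3 - 'X_1 ^+ 3) +
            (3 / 2) *: ('X_0 ^+ 2 * 'X_1 - 'X_0 * 'X_1 ^+ 2))) (- kap1)]
    | [/\ d = 3%N, lam1 = 0
        & alpha' = shifted (p *: ('X_0 ^+ 2 * 'X_1 - 'X_0 * 'X_1 ^+ 2)) (- kap1)] ].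
Proof.
have P_c := coef2_skew P_skew.
have nzP : exists a b, coef2 P a b != 0.
  apply: contrapT => no; case/eqP: nz_a; rewrite -[alpha'](shiftedK _ kap1).
  have -> : shifted alpha' kap1 = 0.
    apply: coef2_inj => a b; have -> : coef2 0 a b = 0 :> k by rewrite /coef2 mcoeff0.
    by apply/eqP; apply: contraT => nz_ab; case: no; exists a, b.
  exact: ev0.
have [d [c_d lamE cases]] := recursion_solutions char_k P_c coef_P_rec nzP.
(* By homogeneity only one antidiagonal of coefficients is left; skew-symmetry then determines half
   of it from the other. *)
have PE : P = \sum_(a < d.+1) coef2 P a (d - a) *: ('X_0 ^+ a * 'X_1 ^+ (d - a)).
  apply: coef2_inj => i j; rewrite {2}/coef2 raddf_sum /=.
  under eq_bigr => a _ do rewrite mcoeffZ -/(coef2 _ i j) coef2_XX.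
  have [ij|ne_ij] := eqVneq (i + j)%N d; last first.
    rewrite c_d // big1 // => a _; case: eqVneq => [ai|]; last by rewrite mulr0.
    case: eqVneq => [aj|]; last by rewrite mulr0.
    by case/eqP: ne_ij; rewrite -ai -aj subnKC // -ltnS.
  have lt_i : (i < d.+1)%N by rewrite -ij ltnS leq_addr.
  have di : (d - i)%N = j by rewrite -ij addKn.
  rewrite (bigD1 (Ordinal lt_i)) //= di !eqxx mulr1 big1 ?addr0 // => a ne_a.
  by rewrite -val_eqE /= in ne_a; rewrite (negPf ne_a) mulr0.
have aE : alpha' = shifted P (- kap1) by rewrite shiftedK.
have c_diag a : coef2 P a a = 0 by apply: (c_diag char_k P_c).
have expand (R : comNzRingType) (c0 c1 : R) (X Y : R) :
    [/\ - c1 * (1 * Y) + c1 * (X * 1) = c1 * (X - Y),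
        - c1 * (1 * Y ^+ 2) + 0 * (X * Y) + c1 * (X ^+ 2 * 1) = c1 * (X ^+ 2 - Y ^+ 2),
        - c1 * (1 * Y ^+ 3) + - (c0 * c1) * (X * Y ^+ 2) + c0 * c1 * (X ^+ 2 * Y) +
          c1 * (X ^+ 3 * 1) = c1 * (X ^+ 3 - Y ^+ 3 + c0 * (X ^+ 2 * Y - X * Y ^+ 2))
      & - 0 * (1 * Y ^+ 3) + - c1 * (X * Y ^+ 2) + c1 * (X ^+ 2 * Y) +
          0 * (X ^+ 3 * 1) = c1 * (X ^+ 2 * Y - X * Y ^+ 2)].
  by split; ring.
case: cases => [dE|[dE lam1E]|[dE lam1E nz30 c21]|[dE lam1E c30]]; subst d;
  rewrite !big_ord_recr big_ord0 /= add0r [coef2 P 0 _]P_c !subSS !subn0 ?c_diag in PE;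
  rewrite !expr0 !expr1 -!mul_mpolyC ?mpolyCN ?mpolyC0 in PE.
- exists 1%N, (coef2 P 1 0); split; first exact: lamE.
  constructor 1; split; first by [].
  rewrite {1}aE {1}PE -mul_mpolyC; congr shifted.
  by case: (expand {mpoly k[2]} 0 (coef2 P 1 0)%:MP 'X_0 'X_1).
- exists 2%N, (coef2 P 2 0); split; first exact: lamE.
  constructor 2; split=> [//|//|].
  rewrite {1}aE {1}PE -mul_mpolyC; congr shifted.
  by case: (expand {mpoly k[2]} 0 (coef2 P 2 0)%:MP 'X_0 'X_1).
- exists 3%N, (coef2 P 3 0); split; first exact: lamE.
  constructor 3; split=> [//|//|].
  rewrite {1}aE {1}PE [coef2 P 1 _]P_c c21 !mpolyCN mpolyCM -!mul_mpolyC; congr shifted.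
  by case: (expand {mpoly k[2]} (3 / 2)%:MP (coef2 P 3 0)%:MP 'X_0 'X_1).
- exists 3%N, (coef2 P 2 1); split; first exact: lamE.
  constructor 4; split=> [//|//|].
  rewrite {1}aE {1}PE [coef2 P 1 _]P_c c30 !mpolyCN mpolyC0 -!mul_mpolyC; congr shifted.
  by case: (expand {mpoly k[2]} 0 (coef2 P 2 1)%:MP 'X_0 'X_1).
Qed.

End Shift.

End Identities.

(** * The five families *)

Section AlphaForms.
Variables (k : fieldType) (char_k : [pchar k] =i pred0).

Definition skewtens i j : {mpoly k[2]} :=
  divpow k i \ox divpow k j - divpow k j \ox divpow k i.

Lemma divpow0 : divpow k 0 = 1.
Proof. by rewrite /divpow expr0 invr1 scale1r. Qed.

Lemma divpow1 : divpow k 1 = 'X.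
Proof. by rewrite /divpow expr1 invr1 scale1r. Qed.

Lemma slot_divpow n (i : 'I_n) a :
  slot i (divpow k a) = (a`!%:R)^-1 *: 'X_i ^+ a.
Proof.
rewrite /slot /divpow map_polyZ hornerZ /= rmorphXn /= map_polyX hornerXn.
by rewrite mul_mpolyC.
Qed.

Lemma skewtensE i j : skewtens i j =
  (i`!%:R * j`!%:R)^-1 *: ('X_0 ^+ i * 'X_1 ^+ j - 'X_0 ^+ j * 'X_1 ^+ i).
Proof.
rewrite /skewtens /tens !slot_divpow -!scalerAl -!scalerAr !scalerA scalerBr.
by rewrite !invfM [X in _ - X *: _]mulrC.
Qed.

Lemma coef2_skewtens i j a b : (i < j)%N -> (a < b)%N ->
  coef2 (skewtens i j) a b = (i`!%:R * j`!%:R)^-1 * ((i == a) && (j == b))%:R.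
Proof.
move=> lt_ij lt_ab; rewrite skewtensE /coef2 mcoeffZ mcoeffB -!/(coef2 _ a b).
rewrite !coef2_XX; congr (_ * _).
case: (j =P a) => [ja|_]; last by rewrite subr0.
by case: (i =P b) => [ib|_]; rewrite ?subr0 //; lia.
Qed.

Lemma fact_neq0 n : n`!%:R != 0 :> k.
Proof. by rewrite natr_eq0_char // -lt0n fact_gt0. Qed.

Lemma coef2_sv_alpha' (w : nat -> nat -> k) m a b : (a < b)%N ->
  coef2 (\sum_(0 <= j < m.+1) \sum_(0 <= i < j) w i j *: skewtens i j) a b =
  if (b <= m)%N then w a b * (a`!%:R * b`!%:R)^-1 else 0.
Proof.
move=> lt_ab; rewrite /coef2 raddf_sum /=.
under eq_bigr => j _ do rewrite raddf_sum /=.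
have inner j : \sum_(0 <= i < j) (w i j *: skewtens i j)@_(mnm2 a b) =
    if j == b then w a b * (a`!%:R * b`!%:R)^-1 else 0.
  have -> : \sum_(0 <= i < j) (w i j *: skewtens i j)@_(mnm2 a b) =
      \sum_(0 <= i < j | i == a) (if j == b then w i j * (i`!%:R * j`!%:R)^-1 else 0).
    rewrite [RHS]big_mkcond; apply: eq_big_nat => i /andP[_ lt_ij].
    rewrite mcoeffZ -/(coef2 _ a b) coef2_skewtens //.
    by case: (i == a); case: (j == b); rewrite ?mulr0 ?mulr1.
  rewrite big_nat1_eq; case: eqP => [->|_]; first by rewrite lt_ab.
  by case: ifP.
under eq_bigr => j _ do rewrite inner.
by rewrite -big_mkcond big_nat1_eq.
Qed.

(** The type is thus the largest exponent occurring in [f], hence intrinsic: writing an explicit [f]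
    in the required form determines m. *)
Lemma sv_alpha'_coef m (f : {mpoly k[2]}) : is_sv_alpha' m.+1 f ->
  (exists2 a, (a < m.+1)%N & coef2 f a m.+1 != 0) /\
  (forall a b, (a < b)%N -> (m.+1 < b)%N -> coef2 f a b = 0).
Proof.
case=> w [[a lt_a nz_w] ->]; split=> [|a' b lt_ab lt_mb].
  exists a => //; rewrite coef2_sv_alpha' // leqnn mulf_neq0 // invr_neq0 //.
  by rewrite mulf_neq0 // fact_neq0.
by rewrite coef2_sv_alpha' // leqNgt lt_mb.
Qed.

Lemma sv_alpha'_inj m n (f : {mpoly k[2]}) : is_sv_alpha' m f -> is_sv_alpha' n f -> m = n.
Proof.
wlog lt_mn : m n / (m < n)%N => [W mf nf|mf].
  by have [/W->|/W/(_ nf mf)|] := ltngtP m n.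
case: n lt_mn => // n lt_mn /sv_alpha'_coef[[a lt_a nz_a] _]; case/eqP: nz_a.
case: m lt_mn mf => [_ ->|m lt_mn /sv_alpha'_coef[_]]; last by apply.
by rewrite /coef2 mcoeff0.
Qed.

Lemma sv_alpha'_neq0 m (f : {mpoly k[2]}) : is_sv_alpha' m.+1 f -> f != 0.
Proof.
case/sv_alpha'_coef=> -[a _ nz_a] _; apply: contraNneq nz_a => ->.
by rewrite /coef2 mcoeff0.
Qed.

Lemma sv_alpha'1 (w : k) : w != 0 -> is_sv_alpha' 1 (w *: skewtens 0 1).
Proof.
move=> nz_w; exists (fun _ _ => w); split; first by exists 0%N.
by rewrite !(big_nat_recl _ _ _ (leq0n _)) !big_geq // add0r !addr0.
Qed.

Lemma sv_alpha'2 w01 w02 w12 : (w02 != 0) || (w12 != 0) ->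
  is_sv_alpha' 2 (w01 *: skewtens 0 1 + w02 *: skewtens 0 2 + w12 *: skewtens 1 2).
Proof.
move=> nz_w.
exists (fun i j => if j == 1%N then w01 else if i == 0%N then w02 else w12); split.
  by case/orP: nz_w; [exists 0%N | exists 1%N].
rewrite unlock /= /skewtens.
rewrite !addr0 add0r.
by rewrite addrA.
Qed.

Lemma sv_alpha'3 w01 w02 w12 w03 : w03 != 0 ->
  is_sv_alpha' 3
    (w01 *: skewtens 0 1 + w02 *: skewtens 0 2 + w12 *: skewtens 1 2 + w03 *: skewtens 0 3).
Proof.
move=> nz_w.
exists (fun i j => if j == 1%N then w01 else if j == 2%N then
   if i == 0%N then w02 else w12 else if i == 0%N then w03 else 0); split.
  by exists 0%N.
rewrite unlock /= /skewtens.
by rewrite !scale0r !addr0 add0r !addrA.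
Qed.

End AlphaForms.

(** * Shifted homogeneous solutions in divided powers, and their identities *)

Section Families.
Variables (k : fieldType) (char_k : [pchar k] =i pred0) (kap : k).

Let nz2 : 2 != 0 :> k. Proof. by rewrite natr_eq0_char. Qed.
Let nz3 : 3 != 0 :> k. Proof. by rewrite natr_eq0_char. Qed.

(** The homogeneous solutions above degree 1: [quad] for lambda_1 = 1/2, [mixed] for 0, [cubic] for
    2/3. *)
Definition quad : {mpoly k[2]} := 'X_0 ^+ 2 - 'X_1 ^+ 2.
Definition mixed : {mpoly k[2]} := 'X_0 ^+ 2 * 'X_1 - 'X_0 * 'X_1 ^+ 2.
Definition cubic : {mpoly k[2]} := ('X_0 ^+ 3 - 'X_1 ^+ 3) + (3 / 2) *: mixed.

Section EvFamilies.
Variables (R : comNzRingType) (h : {rmorphism k -> R}) (u v : R).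

Lemma ev_quad : ev h u v quad = u ^+ 2 - v ^+ 2.
Proof. by rewrite evB !evXn evX0 evX1. Qed.

Lemma ev_mixed : ev h u v mixed = u ^+ 2 * v - u * v ^+ 2.
Proof.
by rewrite evB [X in X - _]evM [X in _ - X]evM !evXn evX0 evX1.
Qed.

Lemma ev_cubic : ev h u v cubic =
  (u ^+ 3 - v ^+ 3) + h (3 / 2) * (u ^+ 2 * v - u * v ^+ 2).
Proof. by rewrite evD evZ ev_mixed evB !evXn evX0 evX1. Qed.

End EvFamilies.

Lemma skewtens01 : skewtens k 0 1 = 'X_1 - 'X_0.
Proof. by rewrite skewtensE !expr0 !expr1 mul1r mulr1 mulr1 invr1 scale1r. Qed.

Lemma skewtens02 : skewtens k 0 2 = 2^-1 *: ('X_1 ^+ 2 - 'X_0 ^+ 2).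
Proof. by rewrite skewtensE !expr0 !mul1r mulr1. Qed.

Lemma skewtens12 : skewtens k 1 2 = 2^-1 *: ('X_0 * 'X_1 ^+ 2 - 'X_0 ^+ 2 * 'X_1).
Proof. by rewrite skewtensE !expr1 mul1r. Qed.

Lemma skewtens03 : skewtens k 0 3 = 6^-1 *: ('X_1 ^+ 3 - 'X_0 ^+ 3).
Proof. by rewrite skewtensE !expr0 !mul1r mulr1. Qed.

Lemma shifted_linear p : shifted (p *: ('X_0 - 'X_1)) (- kap) = - p *: skewtens k 0 1.
Proof.
rewrite skewtens01 /shifted evZ evB evX0 evX1 -!mul_mpolyC !mpolyCN.
rewrite /=; move: (mpolyC _ p) (mpolyC _ kap) 'X_0 'X_1 => P K X0 X1; ring.
Qed.

Lemma shifted_quad p : shifted (p *: quad) (- kap) =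
  (2 * p * kap) *: skewtens k 0 1 + (- (2 * p)) *: skewtens k 0 2.
Proof.
rewrite skewtens01 skewtens02 scalerA (_ : - (2 * p) / 2 = - p); last by field.
rewrite /shifted evZ ev_quad -!mul_mpolyC !mpolyCN !mpolyCM mpolyC_nat.
rewrite /=; move: (mpolyC _ p) (mpolyC _ kap) 'X_0 'X_1 => P K X0 X1; ring.
Qed.

Lemma shifted_mixed p : shifted (p *: mixed) (- kap) =
  (- (p * kap ^+ 2)) *: skewtens k 0 1 + (2 * p * kap) *: skewtens k 0 2 +
  (- (2 * p)) *: skewtens k 1 2.
Proof.
rewrite skewtens01 skewtens02 skewtens12 !scalerA.
have -> : 2 * p * kap / 2 = p * kap by field.
have -> : - (2 * p) / 2 = - p by field.
rewrite /shifted evZ ev_mixed -!mul_mpolyC !mpolyCN !mpolyCM ?rmorphXn /=.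
rewrite /=; move: (mpolyC _ p) (mpolyC _ kap) 'X_0 'X_1 => P K X0 X1; ring.
Qed.

Lemma shifted_cubic p : shifted (p *: cubic) (- kap) =
  (- (9 / 2 * p * kap ^+ 2)) *: skewtens k 0 1 + (9 * p * kap) *: skewtens k 0 2 +
  (- (3 * p)) *: skewtens k 1 2 + (- (6 * p)) *: skewtens k 0 3.
Proof.
rewrite skewtens01 skewtens02 skewtens12 skewtens03 !scalerA.
(* All fractions are expressed through 3/2, which then becomes a variable, so that [ring] meets no
   division in the polynomial ring. *)
have -> : 9 * p * kap / 2 = (3 + 3 / 2) * (p * kap) by field.
have -> : - (3 * p) / 2 = - (3 / 2) * p by field.
have nz6 : 6 != 0 :> k by rewrite natr_eq0_char.
have -> : - (6 * p) / 6 = - p by field.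
have -> : 9 / 2 * p * kap ^+ 2 = (3 + 3 / 2) * (p * kap ^+ 2) by field.
rewrite /shifted evZ ev_cubic -!mul_mpolyC.
move: (3 / 2 : k) => s.
rewrite !(mpolyCN, mpolyCM, mpolyCD, mpolyC_nat, rmorphXn) /=.
rewrite /=; move: (mpolyC _ s) (mpolyC _ p) (mpolyC _ kap) 'X_0 'X_1 => S P K X0 X1; ring.
Qed.

Section Jacobi.
Variables (V : comNzRingType) (h : {rmorphism k -> V}) (u v w : V).

Definition jacobi011 (lam : k) (d : nat) (f : {mpoly k[2]}) : Prop :=
  (h lam * u - v + h kap) * ev h (u + v) w f =
    ev h v w f * (h (2 * lam - d%:R) * u - (v + w) + h (2 * kap)) -
      (h lam * u - w + h kap) * ev h v (u + w) f.

Let h_l lam d : h (2 * lam - d%:R) = 2 * h lam - d%:R.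
Proof. by rewrite rmorphB rmorphM !rmorph_nat. Qed.

Let h_k : h (2 * kap) = 2 * h kap.
Proof. by rewrite rmorphM rmorph_nat. Qed.

Lemma jacobi011_linear lam p : jacobi011 lam 1 (shifted (p *: ('X_0 - 'X_1)) (- kap)).
Proof.
rewrite /jacobi011 !ev_shifted !evZ !evB !evX0 !evX1 h_l h_k rmorphN.
by ring.
Qed.

Lemma jacobi011_quad p : jacobi011 (1 / 2) 2 (shifted (p *: quad) (- kap)).
Proof.
rewrite /jacobi011 !ev_shifted !evZ !ev_quad h_l h_k rmorphN.
have i2 : 2 * h (1 / 2) - 1 = 0.
  by rewrite -(rmorph_nat h 2) -rmorphM div1r divff // rmorph1 subrr.
move: (h _) (h p) (h kap) i2 => i P t i2.
(* To [ring], the image of 1/2 is an unknown i; the defect of the identity is this cofactor times 2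
   i - 1. *)
apply/eqP; rewrite -subr_eq0 -(mul0r (P * u ^+ 2 * (v - w))) -i2; apply/eqP; ring.
Qed.

Lemma jacobi011_mixed p : jacobi011 0 3 (shifted (p *: mixed) (- kap)).
Proof.
rewrite /jacobi011 !ev_shifted !evZ !ev_mixed h_l h_k rmorphN rmorph0.
by ring.
Qed.

(* Both [2 / 3] and [3 / 2] are integer multiples of [i = 1 / 6], so the
   identity is a multiple of [6 i - 1]. *)
Lemma jacobi011_cubic p : jacobi011 (2 / 3) 3 (shifted (p *: cubic) (- kap)).
Proof.
rewrite /jacobi011 !ev_shifted !evZ !ev_cubic h_l h_k rmorphN.
have nz6 : 6 != 0 :> k by rewrite natr_eq0_char.
have i6 : 6 * h 6^-1 - 1 = 0.
  by rewrite -(rmorph_nat h 6) -rmorphM divff // rmorph1 subrr.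
have -> : h (2 / 3) = 4 * h 6^-1.
  rewrite -(rmorph_nat h 4) -rmorphM; congr (h _); field.
  by rewrite nz3 nz6.
have -> : h (3 / 2) = 9 * h 6^-1.
  rewrite -(rmorph_nat h 9) -rmorphM; congr (h _); field.
  by rewrite nz2 nz6.
move: (h _) (h p) (h kap) i6 => i P t i6.
apply/eqP; rewrite -subr_eq0 -(mul0r (P * u ^+ 2 * ((6 * i + 3) *
  ((v - t) ^+ 2 - (w - t) ^+ 2) - (6 * i - 1) * u * (v - w)))) -i6; apply/eqP; ring.
Qed.

(** For constant eta, (1,1,2) is trivial and (0,1,2) reduces to a lambda_1 u + a kappa_1 = 0, so
    only two polynomial conditions remain. *)
Lemma sv_identities_intro lam1 lam2 kap2 (f eta : {mpoly k[2]}) a :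
  eta = a *: 1 -> a * lam1 = 0 -> a * kap = 0 ->
  (h lam1 * u - v + h kap) * ev h (u + v) w f =
    ev h v w f * (h lam2 * u - (v + w) + h kap2) -
      (h lam1 * u - w + h kap) * ev h v (u + w) f ->
  h a * (ev h u v f + ev h v w f - ev h u w f) = 0 ->
  sv_identities lam1 kap lam2 kap2 f eta h u v w.
Proof.
move=> -> al ak H f111.
have hal : h a * h lam1 = 0 by rewrite -rmorphM al rmorph0.
have hak : h a * h kap = 0 by rewrite -rmorphM ak rmorph0.
have E u' v' : ev h u' v' (a *: 1) = h a by rewrite evZ ev1 mulr1.
rewrite /sv_identities !E; split=> //.
- apply/eqP; rewrite -subr_eq0; apply/eqP.
  transitivity (h a * h lam1 * u + h a * h kap); first by ring.
  by rewrite hal hak mul0r addr0.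
- by apply/eqP; rewrite -subr_eq0 -oppr0 -f111; apply/eqP; ring.
- by rewrite subrr.
Qed.

End Jacobi.
End Families.

Section SkewtensForms.
Variables (k : fieldType) (char_k : [pchar k] =i pred0) (kap : k).

Let nz2 : 2 != 0 :> k. Proof. by rewrite natr_eq0_char. Qed.
Let nz3 : 3 != 0 :> k. Proof. by rewrite natr_eq0_char. Qed.

(** The sum telescopes, which is why family (B) allows a nonzero eta. *)
Lemma shifted_linear_cocycle (R : comNzRingType) (h : {rmorphism k -> R}) (u v w : R) p :
  let f := shifted (p *: ('X_0 - 'X_1)) (- kap) in
  ev h u v f + ev h v w f - ev h u w f = 0.
Proof. by rewrite /= !ev_shifted !evZ !evB !evX0 !evX1; ring. Qed.

Lemma skewtens_formB (w : k) :
  w *: (1 \ox 'X - 'X \ox 1) = w *: skewtens k 0 1.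
Proof. by rewrite -divpow1 -(divpow0 k). Qed.

Lemma skewtens_formC (w : k) :
  w *: ((1 \ox divpow k 2 - divpow k 2 \ox 1) - kap *: (1 \ox 'X - 'X \ox 1)) =
  (- (w * kap)) *: skewtens k 0 1 + w *: skewtens k 0 2.
Proof.
by rewrite -divpow1 -(divpow0 k) -!/(skewtens _ _ _) scalerBr scalerA addrC scaleNr.
Qed.

Lemma skewtens_formD (w : k) :
  - w *: (kap *: (1 \ox divpow k 2 - divpow k 2 \ox 1)
          - ('X \ox divpow k 2 - divpow k 2 \ox 'X)
          - (kap ^+ 2 / 2) *: (1 \ox 'X - 'X \ox 1)) =
  (w * kap ^+ 2 / 2) *: skewtens k 0 1 + (- (w * kap)) *: skewtens k 0 2 +
  w *: skewtens k 1 2.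
Proof.
rewrite -divpow1 -(divpow0 k) -!/(skewtens _ _ _).
rewrite !scaleNr !scalerBr !scalerA mulrA.
by ring.
Qed.

Lemma skewtens_formE (w : k) :
  w *: ((1 \ox divpow k 3 - divpow k 3 \ox 1)
        + (1 / 2) *: ('X \ox divpow k 2 - divpow k 2 \ox 'X)
        - (3 * kap / 2) *: (1 \ox divpow k 2 - divpow k 2 \ox 1)
        + (3 / 4 * kap ^+ 2) *: (1 \ox 'X - 'X \ox 1)) =
  (w * (3 / 4 * kap ^+ 2)) *: skewtens k 0 1 + (- (w * (3 * kap / 2))) *: skewtens k 0 2 +
  (w * (1 / 2)) *: skewtens k 1 2 + w *: skewtens k 0 3.
Proof.
rewrite -divpow1 -(divpow0 k) -!/(skewtens _ _ _).
rewrite !(scalerDr, scalerN, scalerA, scaleNr).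
by ring.
Qed.

End SkewtensForms.

Theorem theorem4p5 (k : fieldType) (char_k : [pchar k] =i pred0)
    (L : lmodType {poly k}) (e0 e1 e2 : L) (basis_e : is_basis3 e0 e1 e2)
    (m : nat) (lam1 kap1 lam2 kap2 : k) (alpha' eta : {mpoly k[2]}) :
  (exists br : L -> L -> htens 2 L,
     is_sv_algebra m e0 e1 e2 lam1 kap1 lam2 kap2 alpha' eta br)
  <->
  (* (A) *)
  (m = 0%N /\ alpha' = 0 /\
   exists a : k, [/\ eta = a *: (1 \ox 1), a * lam1 = 0 & a * kap1 = 0])
  \/
  (* (B) *)
  (m = 1%N /\ lam2 = 2 * lam1 - 1 /\ kap2 = 2 * kap1 /\
   (exists w01 : k, alpha' = w01 *: (1 \ox 'X - 'X \ox 1)) /\ alpha' != 0 /\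
   exists a : k, [/\ eta = a *: (1 \ox 1), a * lam1 = 0 & a * kap1 = 0])
  \/
  (* (C) *)
  (m = 2%N /\ lam1 = 1 / 2 /\ lam2 = - 1 /\ kap2 = 2 * kap1 /\ eta = 0 /\
   (exists w02 : k,
      alpha' = w02 *: ((1 \ox divpow k 2 - divpow k 2 \ox 1)
                       - kap1 *: (1 \ox 'X - 'X \ox 1))) /\ alpha' != 0)
  \/
  (* (D) *)
  (m = 2%N /\ lam1 = 0 /\ lam2 = - 3 /\ kap2 = 2 * kap1 /\ eta = 0 /\
   (exists w12 : k,
      alpha' = - w12 *: (kap1 *: (1 \ox divpow k 2 - divpow k 2 \ox 1)
                         - ('X \ox divpow k 2 - divpow k 2 \ox 'X)
                         - (kap1 ^+ 2 / 2) *: (1 \ox 'X - 'X \ox 1)))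
   /\ alpha' != 0)
  \/
  (* (E) *)
  (m = 3%N /\ lam1 = 2 / 3 /\ lam2 = - (5 / 3) /\ kap2 = 2 * kap1 /\ eta = 0 /\
   exists w03 : k, w03 != 0 /\
      alpha' = w03 *: ((1 \ox divpow k 3 - divpow k 3 \ox 1)
                       + (1 / 2) *: ('X \ox divpow k 2 - divpow k 2 \ox 'X)
                       - (3 * kap1 / 2) *: (1 \ox divpow k 2 - divpow k 2 \ox 1)
                       + (3 / 4 * kap1 ^+ 2) *: (1 \ox 'X - 'X \ox 1))).
Proof.
have nz2 : 2 != 0 :> k by rewrite natr_eq0_char.
have nz3 : 3 != 0 :> k by rewrite natr_eq0_char.
have nz6 : 6 != 0 :> k by rewrite natr_eq0_char.
have nz4 : 4 != 0 :> k by rewrite natr_eq0_char.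
split=> [alg|].
- have ids := sv_identities_of_algebra basis_e alg.
  have [br [_ a_sv _]] := alg.
  have [a [etaE al ak]] := eta_const ids.
  have [m0|m_gt0] := posnP m.
    left; split; first exact: m0.
    split; first by move: a_sv; rewrite m0.
    by exists a; rewrite tens11.
  right; have nz_a : alpha' != 0.
    by case: (m) m_gt0 a_sv => // m' _; apply: (sv_alpha'_neq0 char_k).
  have k2E := kap2E ids nz_a.
  have eta0 : a = 0 -> eta = 0 by move=> a0; rewrite etaE a0 scale0r.
  have [d [p [l2E cases]]] := alpha'_cases char_k ids nz_a (sv_alpha'_skew a_sv).
  case: cases => [[dE aE]|[dE l1E aE]|[dE l1E aE]|[dE l1E aE]]; rewrite dE in l2E => {d dE}.
  + left; rewrite shifted_linear in aE.
    have nz_p : - p != 0 by apply: contraNneq nz_a => p0; rewrite aE p0 scale0r.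
    split; first by apply: (sv_alpha'_inj char_k a_sv); rewrite aE; apply: sv_alpha'1.
    split; first exact: l2E.
    split; first exact: k2E.
    split; first by exists (- p); rewrite skewtens_formB.
    by split; [exact: nz_a | exists a; rewrite tens11].
  + right; left; rewrite shifted_quad // in aE.
    have nz_p : - (2 * p) != 0.
      apply: contraNneq nz_a => /eqP; rewrite oppr_eq0 mulf_eq0 (negPf nz2) => /eqP p0.
      by rewrite aE p0 mulr0 mul0r oppr0 !scale0r addr0.
    split.
      apply: (sv_alpha'_inj char_k a_sv); rewrite aE -[X in is_sv_alpha' _ X]addr0.
      by rewrite -(scale0r (skewtens k 1 2)); apply: sv_alpha'2; rewrite nz_p.
    split; first exact: l1E.
    split; first by rewrite l2E l1E; field.
    split; first exact: k2E.
    split.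
      (* As lambda_1 = 1/2 is not 0, a lambda_1 = 0 forces a = 0. *)
      by apply: eta0; move/eqP: al; rewrite l1E mulf_eq0 div1r invr_eq0 (negPf nz2) orbF => /eqP.
    split; last exact: nz_a.
    by exists (- (2 * p)); rewrite aE skewtens_formC mulNr opprK.
  + do 3 right; rewrite shifted_cubic // in aE.
    have nz_p : - (6 * p) != 0.
      apply: contraNneq nz_a => /eqP; rewrite oppr_eq0 mulf_eq0 (negPf nz6) => /eqP p0.
      by rewrite aE p0 !(mulr0, mul0r, oppr0, scale0r, addr0).
    split; first by apply: (sv_alpha'_inj char_k a_sv); rewrite aE; apply: sv_alpha'3.
    split; first exact: l1E.
    split; first by rewrite l2E l1E; field.
    split; first exact: k2E.
    split.
      apply: eta0; move/eqP: al; rewrite l1E !mulf_eq0 invr_eq0 (negPf nz2) (negPf nz3).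
      by rewrite !orbF => /eqP.
    exists (- (6 * p)); split; first exact: nz_p.
    rewrite aE skewtens_formE; congr (_ *: _ + _ *: _ + _ *: _ + _); field => //.
    by rewrite nz4 nz2.
  (* This shape has degree 3 but contains no cubes, so it has type 2. The unexpanded form [aE'] is
     kept for evaluation at second argument 0. *)
  + do 2 right; left; have aE' := aE; rewrite shifted_mixed // in aE.
    have nz_p : - (2 * p) != 0.
      apply: contraNneq nz_a => /eqP; rewrite oppr_eq0 mulf_eq0 (negPf nz2) => /eqP p0.
      by rewrite aE p0 !(mulr0, mul0r, oppr0, scale0r, addr0).
    split.
      by apply: (sv_alpha'_inj char_k a_sv); rewrite aE; apply: sv_alpha'2; rewrite nz_p orbT.
    split; first exact: l1E.
    split; first by rewrite l2E l1E; ring.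
    split; first exact: k2E.
    split.
      (* Here lambda_1 = 0, so a lambda_1 = 0 gives nothing. Instead a nonzero a forces kappa_1 = 0,
         then alpha'(u,0) = 0, and (1,1,1) yields a alpha' = 0. *)
      apply: eta0; apply/eqP; apply: contraT => nz_eta.
      have kap0 : kap1 = 0.
        by move/eqP: ak; rewrite mulf_eq0 (negPf nz_eta) => /eqP.
      have evz u : ev (@mpolyC 2 k) u 0 alpha' = 0.
        rewrite aE' ev_shifted evZ ev_mixed kap0 oppr0 rmorph0 !addr0.
        by rewrite mulr0 expr0n mulr0 subr0 mulr0.
      have := eta_alpha' ids etaE; rewrite !evz addr0 subr0 => /eqP.
      by rewrite scaler_eq0 (negPf nz_eta) (negPf nz_a).
    split; last exact: nz_a.
    exists (- (2 * p)); rewrite aE skewtens_formD; congr (_ *: _ + _ *: _ + _); last by ring.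
    by field.
- have evz (R : comNzRingType) (h : {rmorphism k -> R}) (x y z : R) (f : {mpoly k[2]}) :
    h 0 * (ev h x y f + ev h y z f - ev h x z f) = 0 by rewrite rmorph0 mul0r.
  have z1 (c : k) : 0 * c = 0 by rewrite mul0r.
  case=> [[-> [-> [a [etaE al ak]]]]|].
    apply: (sv_algebra_of_identities basis_e) => // u v w.
    apply: (sv_identities_intro (a := a)) => //; rewrite ?etaE ?tens11 // !ev0.
      by rewrite !(mul0r, mulr0, subr0).
    by rewrite addr0 subr0 mulr0.
  case=> [[-> [-> [-> [[p aE] [nz_a [a [etaE al ak]]]]]]]|].
    rewrite skewtens_formB in aE.
    have nz_p : p != 0 by apply: contraNneq nz_a => p0; rewrite aE p0 scale0r.
    have aE' : alpha' = shifted (- p *: ('X_0 - 'X_1)) (- kap1).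
      by rewrite shifted_linear opprK.
    apply: (sv_algebra_of_identities basis_e) => [|u v w].
      by rewrite aE; apply: sv_alpha'1.
    apply: (sv_identities_intro (a := a)) => //; rewrite ?etaE ?tens11 //.
      by rewrite aE'; apply: jacobi011_linear.
    by rewrite aE' shifted_linear_cocycle mulr0.
  have z0 : 0 = 0 *: 1 :> {mpoly k[2]} by rewrite scale0r.
  case=> [[-> [-> [-> [-> [-> [[w aE] nz_a]]]]]]|].
    rewrite skewtens_formC in aE.
    have nz_w : w != 0.
      by apply: contraNneq nz_a => w0; rewrite aE w0 mul0r oppr0 !scale0r addr0.
    (* The scalar inverts the top coefficient -(2 p) of the shifted form, whose 2 is the factorial
       of the divided power; likewise 6 in degree 3. *)
    have aE' : alpha' = shifted (- (w / 2) *: quad k) (- kap1).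
      rewrite shifted_quad // aE; congr (_ *: _ + _ *: _); by field.
    apply: (sv_algebra_of_identities basis_e) => [|u v w'].
      rewrite aE -[X in is_sv_alpha' _ X]addr0 -(scale0r (skewtens k 1 2)).
      by apply: sv_alpha'2; rewrite nz_w.
    apply: (sv_identities_intro z0) => //; rewrite aE'.
    have -> : -1 = 2 * (1 / 2) - 2%:R :> k by field.
    exact: jacobi011_quad.
  case=> [[-> [-> [-> [-> [-> [[w aE] nz_a]]]]]]|].
    rewrite skewtens_formD in aE.
    have nz_w : w != 0.
      by apply: contraNneq nz_a => w0; rewrite aE w0 !(mul0r, oppr0, scale0r, addr0).
    have aE' : alpha' = shifted (- (w / 2) *: mixed k) (- kap1).
      rewrite shifted_mixed // aE; congr (_ *: _ + _ *: _ + _ *: _); by field.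
    apply: (sv_algebra_of_identities basis_e) => [|u v w'].
      by rewrite aE; apply: sv_alpha'2; rewrite nz_w orbT.
    apply: (sv_identities_intro z0) => //; rewrite aE'.
    have -> : - 3 = 2 * 0 - 3%:R :> k by ring.
    exact: jacobi011_mixed.
  case=> [-> [-> [-> [-> [-> [w [nz_w aE]]]]]]].
  rewrite skewtens_formE in aE.
  have aE' : alpha' = shifted (- (w / 6) *: cubic k) (- kap1).
    rewrite shifted_cubic // aE.
    by congr (_ *: _ + _ *: _ + _ *: _ + _ *: _); field; rewrite ?nz2 ?nz4 ?nz6.
  apply: (sv_algebra_of_identities basis_e) => [|u v w'].
    by rewrite aE; apply: sv_alpha'3.
  apply: (sv_identities_intro z0) => //; rewrite aE'.
  have -> : - (5 / 3) = 2 * (2 / 3) - 3%:R :> k by field.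
  exact: jacobi011_cubic.
Qed.
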